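(* Let $\mathcal C$ be a non-empty class of finite groups closed under taking subgroups, homomorphic images and extensions. Let $(\mathcal G,\Gamma)$ be an injective profinite graph of pro-$\mathcal C$ groups and let $v$ be a vertex of $\Gamma$. Then $\Pi_1^{\mathcal C}(\mathcal G,\Gamma,v)\cong\Pi_1^{\mathcal C}(\mathcal G,\Gamma)$, i.e. the pro-$\mathcal C$ fundamental group at the base point $v$ (defined via paths) is isomorphic to the pro-$\mathcal C$ fundamental group defined by universal $J$-specialisations.
   Context: Graphs. A (profinite) graph is a set (profinite space) $\Gamma$ with a distinguished non-empty (closed) subset $V(\Gamma)$ of vertices, $E(\Gamma)=\Gamma\setminus V(\Gamma)$, and two (continuous) maps $d_0,d_1:\Gamma\to V(\Gamma)$ that are the identity on $V(\Gamma)$. A morphism is a (continuous) map commuting with $d_0,d_1$ (so edges may be sent to vertices). A profinite graph is connected if all its finite quotient graphs are connected. Graphs of groups. A pro-$\mathcal C$ group is an inverse limit of groups in $\mathcal C$. A profinite graph of pro-$\mathcal C$ groups $(\mathcal G,\Gamma)$ over a connected profinite graph $\Gamma$ consists of a continuous surjection $\pi:\mathcal G\to\Gamma$ of profinite spaces whose fibres $\mathcal G(m)=\pi^{-1}(m)$ are pro-$\mathcal C$ groups, such that $(g,h)\mapsto gh^{-1}$ is continuous on $\{(g,h)\in\mathcal G\times\mathcal G:\pi(g)=\pi(h)\}$, together with continuous maps $\partial_i:\mathcal G\to \mathcal G_V=\pi^{-1}(V(\Gamma))$, $i=0,1$, with $\pi\partial_i=d_i\pi$, which are the identity on $\mathcal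 G_V$ and restrict to injective homomorphisms $\mathcal G(m)\to\mathcal G(d_i(m))$. A morphism $(\nu,\nu'):(\mathcal G,\Gamma)\to(\mathcal H,\Delta)$ is a pair of continuous maps $\nu:\mathcal G\to\mathcal H$, $\nu':\Gamma\to\Delta$ commuting with the projections, with $\nu'$ a morphism of graphs, $\nu$ a homomorphism on each fibre and $\nu\partial_i=\partial_i\nu$. $\Pi_1^{\mathcal C}(\mathcal G,\Gamma)$. A Galois $\mathcal C$-covering of $\Gamma$ is a quotient map $\zeta:\Lambda\to A\backslash\Lambda=\Gamma$, where $A$ is a pro-$\mathcal C$ group acting freely on a profinite graph $\Lambda$. The universal $\mathcal C$-covering $\zeta:\widetilde\Gamma\to\Gamma$ is the one with $\widetilde\Gamma$ connected and having no non-trivial connected Galois $\mathcal C$-coverings; its group is $\pi_1^{\mathcal C}(\Gamma)$. A continuous 0-section is a continuous map $j:\Gamma\to\widetilde\Gamma$ with $\zeta j=\mathrm{id}$ and $jd_0=d_0j$; put $J=j(\Gamma)$, and let $\chi(m)\in\pi_1^{\mathcal C}(\Gamma)$ be the unique element with $\chi(m)(jd_1(m))=d_1j(m)$. A $J$-specialisation of $(\mathcal G,\Gamma)$ in a pro-$\mathcal C$ group $H$ is a pair $(\beta,\beta')$, where $\beta:\mathcal G\to H$ is continuous and a homomorphism on each fibre, $\beta':\pi_1^{\mathcal C}(\Gamma)\to H$ is a continuous homomorphism, and $\beta(x)=\beta\partial_0(x)=(\beta'\chi(m))(\beta\partial_1(x))(\beta'\chi(m))^{-1}$ for all $x\in\mathcal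 G$, $m=\pi(x)$. $\Pi_1^{\mathcal C}(\mathcal G,\Gamma)$ is the pro-$\mathcal C$ group with a universal $J$-specialisation $(\nu,\nu')$: every $J$-specialisation $(\beta,\beta')$ in a pro-$\mathcal C$ group $H$ equals $(\delta\nu,\delta\nu')$ for a unique continuous homomorphism $\delta$. (It is independent of $J$.) $(\mathcal G,\Gamma)$ is injective if $\nu$ is injective on every fibre. Abstract fundamental group at a point. For an abstract graph of groups $(\mathcal G,\Gamma)$, $F(\mathcal G,\Gamma)$ is the quotient of the free product of all $\mathcal G(w)$ ($w\in V(\Gamma)$) and the free group on $E(\Gamma)$ by the normal closure of $\{\partial_0(x)^{-1}e\,\partial_1(x)e^{-1}: x\in\mathcal G(e),e\in E(\Gamma)\}$. $\pi_1(\mathcal G,\Gamma,v)$ is the subgroup of elements $|c,\mu|=g_0e_1^{\varepsilon_1}g_1\cdots e_n^{\varepsilon_n}g_n$, where $c$ is a closed edge path $v=v_0,e_1^{\varepsilon_1},v_1,\dots,e_n^{\varepsilon_n},v_n=v$ ($\varepsilon_k=\pm1$) and $\mu=(g_0,\dots,g_n)$, $g_k\in\mathcal G(v_k)$. A morphism $(\alpha,\alpha')$ of graphs of groups induces $|c,\mu|\mapsto|\alpha'(c),\alpha(\mu)|$ on these groups. $\Pi_1^{\mathcal C}(\mathcal G,\Gamma,v)$. An injective profinite graph of pro-$\mathcal C$ groups is an inverse limit $(\mathcal G,\Gamma)=\varprojlim_i(\mathcal G_i,\Gamma_i)$ of finite graphs of groups in $\mathcal C$. With $v_i$ the image of $v$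 in $\Gamma_i$, one defines $\Pi_1^{\mathcal C}(\mathcal G,\Gamma,v)=\varprojlim_i\pi_1(\mathcal G_i,\Gamma_i,v_i)_{\widehat{\mathcal C}}$, where $_{\widehat{\mathcal C}}$ denotes pro-$\mathcal C$ completion and the maps are those induced by the morphisms of the inverse system. *)

(* Defs.v *)
From Stdlib Require Relation_Operators.
From HB Require Import structures.
From mathcomp Require Import all_boot.
From mathcomp Require Import all_classical.
From mathcomp Require Import topology.

Set Implicit Arguments.
Unset Strict Implicit.
Unset Printing Implicit Defensive.

Local Open Scope classical_set_scope.
Local Open Scope group_scope.
Local Open Scope quotient_scope.

HB.mixin Record isTopGroup T of Topological T & Group T := {
  mulg_continuous : continuous (fun p : T * T => p.1 * p.2);
  invg_continuous : continuous (fun x : T => x^-1)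
}.

#[short(type="topGroupType")]
HB.structure Definition TopGroup :=
  {T of Topological T & Group T & isTopGroup T}.

Definition is_hom (G H : groupType) (f : G -> H) : Prop :=
  {morph f : x y / x * y >-> x * y}.

Definition continuous_hom (G H : topGroupType) (f : G -> H) : Prop :=
  continuous f /\ is_hom f.

Definition topgroup_isomorphic (G H : topGroupType) : Prop :=
  exists (f : G -> H) (g : H -> G),
    [/\ continuous_hom f, continuous_hom g, cancel f g & cancel g f].

(* Closure under isomorphism is contained in the clauses on injective and on
   surjective homomorphisms. *)
Record extension_closed_class (C : groupType -> Prop) : Prop := {
  class_finite : forall G, C G -> finite_set [set: G];
  class_nonempty : exists G, C G;
  class_subgroup : forall (G H : groupType) (f : H -> G),
    is_hom f -> injective f -> C G -> C H;
  class_image : forall (G H : groupType) (f : G -> H),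
    is_hom f -> set_surj [set: G] [set: H] f -> C G -> C H;
  class_extension : forall (K G Q : groupType) (f : K -> G) (g : G -> Q),
    is_hom f -> injective f -> is_hom g -> set_surj [set: G] [set: Q] g ->
    range f = [set x | g x = 1] -> C K -> C Q -> C G
}.

Record directed_poset (I : Type) (le : I -> I -> Prop) : Prop := {
  dp_inhabited : inhabited I;
  dp_refl : forall i, le i i;
  dp_antisym : forall i j, le i j -> le j i -> i = j;
  dp_trans : forall i j k, le i j -> le j k -> le i k;
  dp_directed : forall i j, exists k, le i k /\ le j k
}.

(* A transition map [phi i j : X j -> X i] is meaningful only for [le i j]; its
   value for other pairs of indices is never used. *)
Record inverse_system (I : Type) (le : I -> I -> Prop)
    (X : I -> topologicalType) (phi : forall i j, X j -> X i) : Prop := {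
  sys_continuous : forall i j, le i j -> continuous (phi i j);
  sys_id : forall i x, phi i i x = x;
  sys_comp : forall i j k, le i j -> le j k ->
    forall x, phi i j (phi j k x) = phi i k x
}.

Definition cone (I : Type) (le : I -> I -> Prop) (X : I -> topologicalType)
    (phi : forall i j, X j -> X i) (Y : topologicalType)
    (q : forall i, Y -> X i) : Prop :=
  (forall i, continuous (q i)) /\
  (forall i j, le i j -> forall y, phi i j (q j y) = q i y).

Record inverse_limit (I : Type) (le : I -> I -> Prop)
    (X : I -> topologicalType) (phi : forall i j, X j -> X i)
    (L : topologicalType) (p : forall i, L -> X i) : Prop := {
  il_system : inverse_system le phi;
  il_cone : cone le phi p;
  il_universal : forall (Y : topologicalType) (q : forall i, Y -> X i),
    cone le phi q ->
    exists! u : Y -> L, continuous u /\ (forall i y, p i (u y) = q i y)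
}.

Definition is_proC (C : groupType -> Prop) (G : topGroupType) : Prop :=
  exists (I : Type) (le : I -> I -> Prop) (K : I -> groupType)
    (phi : forall i j, K j -> K i) (p : forall i, G -> K i),
    [/\ directed_poset le /\ (forall i, C (K i)),
        (forall i j, le i j -> is_hom (phi i j)),
        (forall i, is_hom (p i)) &
        @inverse_limit I le (fun i => discrete_topology (K i)) phi G p].

Record normal_subgroup (G : groupType) := NormalSubgroup {
  ns_set : set G;
  ns_1 : ns_set 1;
  ns_M : forall x y, ns_set x -> ns_set y -> ns_set (x * y);
  ns_V : forall x, ns_set x -> ns_set x^-1;
  ns_J : forall x y, ns_set x -> ns_set (x ^ y)
}.

Section Quotient.
Variables (G : groupType) (N : normal_subgroup G).

Definition coset_rel : rel G := fun x y => `[< ns_set N (x^-1 * y) >].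

Lemma coset_rel_refl : reflexive coset_rel.
Proof. by move=> x; apply/asboolP; rewrite mulVg; exact: ns_1. Qed.

Lemma coset_rel_sym : symmetric coset_rel.
Proof.
suff S x y : coset_rel x y -> coset_rel y x.
  by move=> x y; apply/idP/idP; exact: S.
move=> /asboolP Nxy; apply/asboolP.
by move: (ns_V Nxy); rewrite invgM invgK.
Qed.

Lemma coset_rel_trans : transitive coset_rel.
Proof.
move=> y x z /asboolP Nxy /asboolP Nyz; apply/asboolP.
by move: (ns_M Nxy Nyz); rewrite mulgA mulgK.
Qed.

Canonical coset_equiv :=
  EquivRel coset_rel coset_rel_refl coset_rel_sym coset_rel_trans.

Definition quotient_group : Type := {eq_quot coset_equiv}.
HB.instance Definition _ := Choice.on quotient_group.

Definition to_quotient (x : G) : quotient_group := \pi_({eq_quot coset_equiv}) x.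
Definition of_quotient (a : quotient_group) : G :=
  repr (a : {eq_quot coset_equiv}).

Lemma of_quotientK a : to_quotient (of_quotient a) = a.
Proof. exact: reprK. Qed.

Lemma to_quotientP x y : to_quotient x = to_quotient y <-> ns_set N (x^-1 * y).
Proof.
split; first by move=> /eqquotP /asboolP.
by move=> h; apply/eqquotP; apply/asboolP.
Qed.

Definition quotient_mul (a b : quotient_group) : quotient_group :=
  to_quotient (of_quotient a * of_quotient b).
Definition quotient_inv (a : quotient_group) : quotient_group :=
  to_quotient (of_quotient a)^-1.

Lemma to_quotientM x y :
  quotient_mul (to_quotient x) (to_quotient y) = to_quotient (x * y).
Proof.
rewrite /quotient_mul; apply/to_quotientP.
set x' := of_quotient _; set y' := of_quotient (to_quotient y).
have Nx : ns_set N (x'^-1 * x) by apply/to_quotientP; rewrite of_quotientK.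
have Ny : ns_set N (y'^-1 * y) by apply/to_quotientP; rewrite of_quotientK.
rewrite invgM -mulgA [x'^-1 * _]mulgA.
have -> : y'^-1 * (x'^-1 * x * y) = (y'^-1 * y) * (x'^-1 * x) ^ y.
  by rewrite conjgE !mulgA mulgK.
by apply: ns_M => //; exact: ns_J.
Qed.

Lemma to_quotientV x : quotient_inv (to_quotient x) = to_quotient x^-1.
Proof.
rewrite /quotient_inv; apply/to_quotientP.
set x' := of_quotient _.
have Nx : ns_set N (x'^-1 * x) by apply/to_quotientP; rewrite of_quotientK.
have -> : x'^-1^-1 * x^-1 = ((x'^-1 * x)^-1) ^ (x'^-1).
  by rewrite conjgE !invgM !invgK !mulgA mulgK.
by apply: ns_J; exact: ns_V.
Qed.

Lemma quotient_mulA : associative quotient_mul.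
Proof.
move=> a b c; rewrite -[a]of_quotientK -[b]of_quotientK -[c]of_quotientK.
by rewrite !to_quotientM mulgA.
Qed.
Lemma quotient_mul1 : left_id (to_quotient 1) quotient_mul.
Proof. by move=> a; rewrite -[a]of_quotientK to_quotientM mul1g. Qed.
Lemma quotient_mulr1 : right_id (to_quotient 1) quotient_mul.
Proof. by move=> a; rewrite -[a]of_quotientK to_quotientM mulg1. Qed.
Lemma quotient_mulV : left_inverse (to_quotient 1) quotient_inv quotient_mul.
Proof.
by move=> a; rewrite -[a]of_quotientK to_quotientV to_quotientM mulVg.
Qed.
Lemma quotient_mulrV : right_inverse (to_quotient 1) quotient_inv quotient_mul.
Proof.
by move=> a; rewrite -[a]of_quotientK to_quotientV to_quotientM mulgV.
Qed.

HB.instance Definition _ := isGroup.Build quotient_group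
  quotient_mulA quotient_mul1 quotient_mulr1 quotient_mulV quotient_mulrV.

End Quotient.

Section Completion.
Variables (C : groupType -> Prop) (G : groupType).

Definition C_index : Type := {N : normal_subgroup G | C (quotient_group N)}.
Definition C_index_le (M N : C_index) : Prop := ns_set (sval N) `<=` ns_set (sval M).
Definition C_quotient (N : C_index) : groupType := quotient_group (sval N).

(* For [C_index_le M N], i.e. N a subset of M, this is the canonical
   projection G/N -> G/M. *)
Definition C_proj (M N : C_index) (a : C_quotient N) : C_quotient M :=
  to_quotient (sval M) (of_quotient a).

(* The index set of the inverse limit consists of all normal subgroups N of G
   with G/N in C. *)
Definition is_proC_completion (Gh : topGroupType) (iota : G -> Gh) : Prop :=
  exists p : forall N : C_index, Gh -> C_quotient N,
    [/\ @inverse_limit C_index C_index_le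
          (fun N => discrete_topology (C_quotient N)) C_proj Gh p,
        (forall N, is_hom (p N)) &
        (forall N x, p N (iota x) = to_quotient (sval N) x)].
End Completion.

Definition profinite (T : topologicalType) : Prop :=
  [/\ compact [set: T], hausdorff_space T & totally_disconnected [set: T]].

(* [gd false] is d_0 and [gd true] is d_1. *)
Record pgraph := PGraph {
  gsort :> topologicalType;
  vtx : set gsort;
  gd : bool -> gsort -> gsort;
  pg_profinite : profinite gsort;
  vtx_nonempty : vtx !=set0;
  vtx_closed : closed vtx;
  gd_continuous : forall i, continuous (gd i);
  gd_vtx : forall i m, vtx (gd i m);
  gd_id : forall i m, vtx m -> gd i m = m
}.

Definition graph_morphism (X Y : pgraph) (f : X -> Y) : Prop :=
  continuous f /\ (forall i m, f (gd i m) = gd i (f m)).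

Definition abstractly_connected (X : pgraph) : Prop :=
  forall v w : X, vtx v -> vtx w ->
    Relation_Operators.clos_refl_sym_trans X
      (fun a b => exists e : X, gd false e = a /\ gd true e = b) v w.

Definition connected_graph (X : pgraph) : Prop :=
  forall (D : pgraph) (f : X -> D), finite_set [set: D] ->
    graph_morphism f -> set_surj [set: X] [set: D] f -> abstractly_connected D.

Record galois_cover (C : groupType -> Prop) (X : pgraph) := GaloisCover {
  cover :> pgraph;
  cgrp : topGroupType;
  cgrp_proC : is_proC C cgrp;
  act : cgrp -> cover -> cover;
  act_continuous : continuous (fun p : cgrp * cover => act p.1 p.2);
  act_1 : forall x, act 1 x = x;
  act_M : forall a b x, act (a * b) x = act a (act b x);
  act_gd : forall a i x, gd i (act a x) = act a (gd i x);
  act_free : forall a x, act a x = x -> a = 1;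
  zeta : cover -> X;
  zeta_morphism : graph_morphism zeta;
  zeta_surj : set_surj [set: cover] [set: X] zeta;
  zeta_orbit : forall x y, zeta x = zeta y <-> exists a, y = act a x
}.

Definition universal_cover (C : groupType -> Prop) (X : pgraph)
    (U : galois_cover C X) : Prop :=
  connected_graph U /\
  (forall D : galois_cover C U, connected_graph D -> injective (zeta (g := D))).

Definition zero_section (C : groupType -> Prop) (X : pgraph)
    (U : galois_cover C X) (j : X -> U) : Prop :=
  [/\ continuous j, (forall m, zeta (j m) = m) &
      (forall m, j (gd false m) = gd false (j m))].

(* The element in braces exists and is unique when [j] is a 0-section. *)
Definition chi (C : groupType -> Prop) (X : pgraph) (U : galois_cover C X)
    (j : X -> U) (m : X) : cgrp U :=
  xget 1 [set a | act a (j (gd true m)) = gd true (j m)].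

(* [inc m] identifies the group [fib m] with the fibre of [gpi] over [m]; for a
   compact [fib m] it is automatically a homeomorphism onto that fibre. Fibres
   contain a unit, so [gpi] is surjective.
   [bd false] and [bd true] are the maps partial_0 and partial_1; by [bd_pi]
   they take values above the vertices. *)
Record pgog := PGoG {
  base : pgraph;
  base_connected : connected_graph base;
  tot : topologicalType;
  tot_profinite : profinite tot;
  gpi : tot -> base;
  gpi_continuous : continuous gpi;
  fib : base -> topGroupType;
  inc : forall m, fib m -> tot;
  inc_continuous : forall m, continuous (inc (m := m));
  inc_injective : forall m, injective (inc (m := m));
  inc_range : forall m, range (inc (m := m)) = gpi @^-1` [set m];
  div_continuous : exists dv : tot * tot -> tot,
    {within [set p | gpi p.1 = gpi p.2], continuous dv} /\
    (forall m (g h : fib m), dv (inc g, inc h) = inc (g * h^-1));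
  bd : bool -> tot -> tot;
  bd_continuous : forall i, continuous (bd i);
  bd_pi : forall i x, gpi (bd i x) = gd i (gpi x);
  bd_id : forall i x, vtx (gpi x) -> bd i x = x;
  bd_fib : forall i m, exists f : fib m -> fib (gd i m),
    [/\ is_hom f, injective f & forall g, bd i (inc g) = inc (f g)]
}.

Definition proC_gog (C : groupType -> Prop) (GG : pgog) : Prop :=
  forall m : base GG, is_proC C (fib m).

(* A finite profinite space is discrete, so this is a finite graph of groups
   in C. *)
Definition finite_gog (C : groupType -> Prop) (GG : pgog) : Prop :=
  [/\ finite_set [set: base GG], finite_set [set: tot GG] &
      forall m : base GG, C (fib m)].

Definition gog_morphism (GG HH : pgog) (nu : tot GG -> tot HH)
    (nu' : base GG -> base HH) : Prop :=
  [/\ continuous nu, graph_morphism nu', (forall x, gpi (nu x) = nu' (gpi x)),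
      (forall m : base GG, exists f : fib m -> fib (nu' m),
         is_hom f /\ (forall g, nu (inc g) = inc (f g))) &
      (forall i x, nu (bd i x) = bd i (nu x))].

Definition fibre_hom (GG : pgog) (H : groupType) (b : tot GG -> H) : Prop :=
  forall m : base GG, is_hom (fun g : fib m => b (inc g)).

Definition J_specialisation (C : groupType -> Prop) (GG : pgog)
    (U : galois_cover C (base GG)) (j : base GG -> U) (H : topGroupType)
    (b : tot GG -> H) (b' : cgrp U -> H) : Prop :=
  [/\ continuous b, fibre_hom b, continuous_hom b' &
      forall x, b x = b (bd false x) /\
        b x = b' (chi j (gpi x)) * b (bd true x) * (b' (chi j (gpi x)))^-1].

Definition universal_J_specialisation (C : groupType -> Prop) (GG : pgog)
    (U : galois_cover C (base GG)) (j : base GG -> U) (P : topGroupType)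
    (nu : tot GG -> P) (nu' : cgrp U -> P) : Prop :=
  J_specialisation j nu nu' /\
  (forall (H : topGroupType) (b : tot GG -> H) (b' : cgrp U -> H),
     is_proC C H -> J_specialisation j b b' ->
     exists! delta : P -> H,
       [/\ continuous_hom delta, b = delta \o nu & b' = delta \o nu']).

(* [P] together with [nu : tot GG -> P] is Pi_1^C(GG, base GG). *)
Definition is_Pi1 (C : groupType -> Prop) (GG : pgog) (P : topGroupType)
    (nu : tot GG -> P) : Prop :=
  is_proC C P /\
  exists (U : galois_cover C (base GG)) (j : base GG -> U) (nu' : cgrp U -> P),
    [/\ universal_cover U, zero_section j & universal_J_specialisation j nu nu'].

Definition injective_gog (C : groupType -> Prop) (GG : pgog) : Prop :=
  exists (P : topGroupType) (nu : tot GG -> P), is_Pi1 C nu /\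
    (forall m : base GG, injective (fun g : fib m => nu (inc g))).

(* Elements of the vertex groups, and edges with an exponent:
   [LE e true] is e and [LE e false] is e^-1. *)
Inductive letter (GG : pgog) :=
| LV (x : tot GG) of vtx (gpi x)
| LE (e : base GG) of ~ vtx e & bool.

HB.instance Definition _ GG := gen_eqMixin (letter GG).
HB.instance Definition _ GG := gen_choiceMixin (letter GG).

Section AbstractGroup.
Variable GG : pgog.

Definition word := seq (letter GG).

(* The smallest congruence on words given by the defining relations of the free
   product of the vertex groups and of the free group on the edges, together
   with e partial_1(x) e^-1 = partial_0(x). *)
Inductive word_eq : word -> word -> Prop :=
| we_refl u : word_eq u u
| we_sym u v : word_eq u v -> word_eq v u
| we_trans u v w : word_eq u v -> word_eq v w -> word_eq u w
| we_cat u u' v v' : word_eq u u' -> word_eq v v' -> word_eq (u ++ v) (u' ++ v')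
| we_one (m : base GG) (h : vtx (gpi (inc (1 : fib m)))) : word_eq [:: LV h] [::]
| we_mul (m : base GG) (x y : fib m) (hx : vtx (gpi (inc x))) (hy : vtx (gpi (inc y)))
    (hxy : vtx (gpi (inc (x * y)))) : word_eq [:: LV hx; LV hy] [:: LV hxy]
| we_edge e (h : ~ vtx e) b : word_eq [:: LE h b; LE h (~~ b)] [::]
| we_rel x (he : ~ vtx (gpi x)) (h0 : vtx (gpi (bd false x)))
    (h1 : vtx (gpi (bd true x))) :
    word_eq [:: LE he true; LV h1; LE he false] [:: LV h0].

Definition word_rel : rel word := fun u v => `[< word_eq u v >].
Lemma word_rel_refl : reflexive word_rel.
Proof. by move=> u; apply/asboolP; exact: we_refl. Qed.
Lemma word_rel_sym : symmetric word_rel.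
Proof.
by move=> u v; apply/asboolP/asboolP; exact: we_sym.
Qed.
Lemma word_rel_trans : transitive word_rel.
Proof.
by move=> v u w /asboolP uv /asboolP vw; apply/asboolP; exact: we_trans vw.
Qed.
Canonical word_equiv :=
  EquivRel word_rel word_rel_refl word_rel_sym word_rel_trans.

(* F(GG, base GG). *)
Definition Fgroup : Type := {eq_quot word_equiv}.
HB.instance Definition _ := Choice.on Fgroup.

Definition wclass (u : word) : Fgroup := \pi_({eq_quot word_equiv}) u.
Definition wrepr (a : Fgroup) : word := repr (a : {eq_quot word_equiv}).

Lemma wreprK a : wclass (wrepr a) = a.
Proof. exact: reprK. Qed.

Lemma wclassP u v : wclass u = wclass v <-> word_eq u v.
Proof.
split; first by move=> /eqquotP /asboolP.
by move=> h; apply/eqquotP; apply/asboolP.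
Qed.

Lemma wreprP u : word_eq (wrepr (wclass u)) u.
Proof. by apply/wclassP; rewrite wreprK. Qed.

Lemma inc_surj (x : tot GG) : exists g : fib (gpi x), inc g = x.
Proof.
have : (@gpi GG @^-1` [set gpi x]) x by [].
by rewrite -(inc_range (gpi x)) => -[g _ e]; exists g.
Qed.

Lemma gpi_inc (m : base GG) (g : fib m) : gpi (inc g) = m.
Proof. by have : range (@inc GG m) (inc g) by []; rewrite inc_range. Qed.

Definition fib_elt (x : tot GG) : fib (gpi x) := projT1 (cid (inc_surj x)).
Lemma fib_eltK x : inc (fib_elt x) = x.
Proof. exact: (projT2 (cid (inc_surj x))). Qed.

Definition tinv (x : tot GG) : tot GG := inc (fib_elt x)^-1.
Lemma gpi_tinv x : gpi (tinv x) = gpi x.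
Proof. exact: gpi_inc. Qed.
Lemma vtx_tinv x : vtx (gpi x) -> vtx (gpi (tinv x)).
Proof. by rewrite gpi_tinv. Qed.

Definition linv (l : letter GG) : letter GG :=
  match l with LV _ h => LV (vtx_tinv h) | LE _ h b => LE h (~~ b) end.
Definition winv (u : word) : word := rev (map linv u).

Lemma LV_mul (m : base GG) (x y : fib m) a b (ha : vtx (gpi a)) (hb : vtx (gpi b)) :
  a = inc x -> b = inc y -> x * y = 1 -> word_eq [:: LV ha; LV hb] [::].
Proof.
move=> ea eb xy; subst a b.
have h : vtx (gpi (inc (x * y))) by move: ha; rewrite !gpi_inc.
apply: (we_trans (we_mul ha hb h)).
by move: h; rewrite xy => h; exact: we_one.
Qed.

Lemma linvr l : word_eq [:: l; linv l] [::].
Proof.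
case: l => [x h|e h b] /=; last exact: we_edge.
apply: (@LV_mul _ (fib_elt x) (fib_elt x)^-1) => //; first by rewrite fib_eltK.
exact: mulgV.
Qed.

Lemma linvl l : word_eq [:: linv l; l] [::].
Proof.
case: l => [x h|e h b] /=.
  apply: (@LV_mul _ (fib_elt x)^-1 (fib_elt x)) => //; first by rewrite fib_eltK.
  exact: mulVg.
by move: (we_edge h (~~ b)); rewrite negbK.
Qed.

Lemma winvr u : word_eq (u ++ winv u) [::].
Proof.
elim: u => [|l u ih]; first exact: we_refl.
rewrite /winv map_cons rev_cons -cats1 -/(winv u) /= catA.
have := we_cat (we_refl [:: l]) (we_cat ih (we_refl [:: linv l])).
by move=> /= H; apply: (we_trans H); exact: linvr.
Qed.

Lemma winvl u : word_eq (winv u ++ u) [::].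
Proof.
elim: u => [|l u ih]; first exact: we_refl.
rewrite /winv map_cons rev_cons -cats1 -/(winv u) -catA /=.
have := we_cat (we_refl (winv u)) (we_cat (linvl l) (we_refl u)).
by move=> /= H; apply: (we_trans H).
Qed.

Definition Fmul (a b : Fgroup) : Fgroup := wclass (wrepr a ++ wrepr b).
Definition Finv (a : Fgroup) : Fgroup := wclass (winv (wrepr a)).

Lemma FmulE u v : Fmul (wclass u) (wclass v) = wclass (u ++ v).
Proof. by apply/wclassP; apply: we_cat; exact: wreprP. Qed.
Lemma FmulA : associative Fmul.
Proof.
move=> a b c; rewrite -[a]wreprK -[b]wreprK -[c]wreprK.
by rewrite !FmulE catA.
Qed.
Lemma Fmul1 : left_id (wclass [::]) Fmul.
Proof. by move=> a; rewrite -[a]wreprK FmulE. Qed.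
Lemma Fmulr1 : right_id (wclass [::]) Fmul.
Proof. by move=> a; rewrite -[a]wreprK FmulE cats0. Qed.
Lemma FmulV : left_inverse (wclass [::]) Finv Fmul.
Proof.
by move=> a; rewrite -{2}[a]wreprK FmulE; apply/wclassP; exact: winvl.
Qed.
Lemma FmulrV : right_inverse (wclass [::]) Finv Fmul.
Proof.
by move=> a; rewrite -{1}[a]wreprK FmulE; apply/wclassP; exact: winvr.
Qed.

HB.instance Definition _ :=
  isGroup.Build Fgroup FmulA Fmul1 Fmulr1 FmulV FmulrV.

(* The images in F of an element of a vertex group and of e^{+-1}. The value of
   [Fedge] at a vertex is 1, which is what makes |alpha'(c), alpha(mu)| below
   meaningful when a morphism sends edges of c to vertices. *)
Definition Fvertex (x : tot GG) : Fgroup :=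
  if pselect (vtx (gpi x)) is left h then wclass [:: LV h] else 1.
Definition Fedge (e : base GG) (b : bool) : Fgroup :=
  if pselect (vtx e) is right h then wclass [:: LE h b] else 1.

(* [(g0, [:: (e1, b1, g1); ...; (en, bn, gn)])] encodes the pair (c, mu) with
   c = e1^{+-1}, ..., en^{+-1} and mu = (g0, ..., gn). *)
Definition gpath : Type := (tot GG * seq (base GG * bool * tot GG))%type.

(* Steps along a vertex (from that vertex to itself) are allowed, so that
   the image of a path under a morphism is a path; by the convention for
   [Fedge] they do not create new elements |c, mu|. *)
Fixpoint steps (v : base GG) (s : seq (base GG * bool * tot GG)) (w : base GG) :
    Prop :=
  if s is (e, b, g) :: s' then
    [/\ gd (~~ b) e = v, gpi g = gd b e & steps (gd b e) s' w]
  else v = w.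

Definition closed_path (v : base GG) (c : gpath) : Prop :=
  gpi c.1 = v /\ steps v c.2 v.

Definition steps_elt (s : seq (base GG * bool * tot GG)) : Fgroup :=
  \prod_(t <- s) (Fedge t.1.1 t.1.2 * Fvertex t.2).

(* |c, mu| *)
Definition path_elt (c : gpath) : Fgroup := Fvertex c.1 * steps_elt c.2.

Definition pi1_pred (v : base GG) : pred Fgroup :=
  fun x => `[< exists2 c, closed_path v c & x = path_elt c >].

Lemma Fvertex_inc1 (m : base GG) : Fvertex (inc (1 : fib m)) = 1.
Proof.
rewrite /Fvertex; case: pselect => // h.
by apply/wclassP; exact: we_one.
Qed.

Lemma FvertexV x : (Fvertex x)^-1 = Fvertex (tinv x).
Proof.
apply/eqP; rewrite eq_sym -mulg_eq1 /Fvertex.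
case: pselect => h; case: pselect => h'.
- have -> : (wclass [:: LV h] * wclass [:: LV h'] : Fgroup) =
    wclass ([:: LV h] ++ [:: LV h']) by exact: FmulE.
  apply/eqP/wclassP.
  apply: (@LV_mul _ (fib_elt x)^-1 (fib_elt x)) => //.
    by rewrite fib_eltK.
  exact: mulVg.
- by case: h'; rewrite -gpi_tinv.
- by case: h; rewrite gpi_tinv.
- by rewrite mulg1.
Qed.

Lemma FedgeV e b : (Fedge e b)^-1 = Fedge e (~~ b).
Proof.
apply/eqP; rewrite eq_sym -mulg_eq1 /Fedge.
case: pselect => h; first by rewrite mulg1.
have -> : (wclass [:: LE h (~~ b)] * wclass [:: LE h b] : Fgroup) =
    wclass ([:: LE h (~~ b)] ++ [:: LE h b]) by exact: FmulE.
apply/eqP/wclassP => /=.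
by move: (we_edge h (~~ b)); rewrite negbK.
Qed.

Lemma steps_cat u v w s t : steps u s v -> steps v t w -> steps u (s ++ t) w.
Proof.
elim: s u => [|[[e b] g] s ih] u /=; first by move=> ->.
by case=> h1 h2 h3 ht; split => //; exact: ih.
Qed.

Lemma Fvertex_nonvertex x : ~ vtx (gpi x) -> Fvertex x = 1.
Proof. by rewrite /Fvertex; case: pselect. Qed.
Lemma Fedge_vertex e b : vtx e -> Fedge e b = 1.
Proof. by rewrite /Fedge; case: pselect. Qed.

Lemma steps_elt_cons t s :
  steps_elt (t :: s) = Fedge t.1.1 t.1.2 * Fvertex t.2 * steps_elt s.
Proof. by rewrite /steps_elt big_cons. Qed.

Lemma steps_inv v w s (g0 : tot GG) : vtx v -> gpi g0 = v -> steps v s w ->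
  exists c, [/\ gpi c.1 = w, steps w c.2 v &
    (Fvertex g0 * steps_elt s)^-1 = path_elt c].
Proof.
elim: s v g0 => [|[[e b] g] s ih] v g0 hv hg /=.
  move=> <-; exists (tinv g0, [::]); split => //=; first by rewrite gpi_tinv.
  by rewrite /path_elt /steps_elt !big_nil !mulg1 FvertexV.
case=> h1 h2 h3.
have [c [c1 c2 c3]] := ih _ g (gd_vtx b e) h2 h3.
exists (c.1, rcons c.2 (e, ~~ b, tinv g0)); split => //=.
  rewrite -cats1; apply: steps_cat c2 _ => /=.
  by rewrite negbK h1 gpi_tinv hg; split.
have -> : path_elt (c.1, rcons c.2 (e, ~~ b, tinv g0)) =
    path_elt c * (Fedge e (~~ b) * Fvertex (tinv g0)).
  by rewrite /path_elt /steps_elt /= -cats1 big_cat big_seq1 mulgA.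
rewrite -c3 steps_elt_cons /=.
by rewrite !invgM !FvertexV !FedgeV !mulgA.
Qed.

Lemma pi1_nonvertex v x : ~ vtx v -> x \in pi1_pred v -> x = 1.
Proof.
move=> hv /asboolP[[g s] [/= hg hs] ->]; rewrite /path_elt /=.
case: s hs => [_|[[e b] h] s [h1]]; last by case: hv; rewrite -h1; exact: gd_vtx.
by rewrite /steps_elt big_nil mulg1 Fvertex_nonvertex // hg.
Qed.

Lemma pi1_1 v : 1 \in pi1_pred v.
Proof.
apply/asboolP; exists (inc (1 : fib v), [::]).
  by split => //=; exact: gpi_inc.
by rewrite /path_elt /steps_elt big_nil mulg1 Fvertex_inc1.
Qed.

Lemma pi1_group_closed v : group_closed (pi1_pred v).
Proof.
have [hv|hv] := pselect (vtx v); last first.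
  split=> [|x y]; first exact: pi1_1.
  move=> /(pi1_nonvertex hv) -> /(pi1_nonvertex hv) ->.
  by rewrite divg1; exact: pi1_1.
have M x y : x \in pi1_pred v -> y \in pi1_pred v -> x * y \in pi1_pred v.
  move=> /asboolP[c [c1 c2] ->] /asboolP[d [d1 d2] ->]; apply/asboolP.
  exists (c.1, c.2 ++ (v, true, d.1) :: d.2).
    split => //=; apply: steps_cat c2 _ => /=; rewrite !gd_id //.
  rewrite /path_elt /steps_elt big_cat big_cons /= Fedge_vertex // mul1g.
  by rewrite !mulgA.
have V x : x \in pi1_pred v -> x^-1 \in pi1_pred v.
  move=> /asboolP[[g s] [/= hg hs] ->]; apply/asboolP.
  by have [c [? ? ?]] := steps_inv hv hg hs; exists c.
split=> [|x y hx hy]; first exact: pi1_1.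
by apply: M => //; exact: V.
Qed.

(* pi_1(GG, base GG, v); it is the trivial group when [v] is not a vertex. *)
Record pi1 (v : base GG) := Pi1 { pi1_val : Fgroup; pi1_valP : pi1_pred v pi1_val }.

HB.instance Definition _ v := [isSub for @pi1_val v].
HB.instance Definition _ v := [Choice of pi1 v by <:].
HB.instance Definition _ v :=
  SubChoice_isSubGroup.Build Fgroup (pi1_pred v) (pi1 v) (pi1_group_closed v).

End AbstractGroup.

Definition map_path (GG HH : pgog) (al : tot GG -> tot HH)
    (al' : base GG -> base HH) (c : gpath GG) : gpath HH :=
  (al c.1, [seq (al' t.1.1, t.1.2, al t.2) | t <- c.2]).

(* [a] is the map |c, mu| |-> |al'(c), al(mu)|. *)
Definition induced_map (GG HH : pgog) (al : tot GG -> tot HH)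
    (al' : base GG -> base HH) (v : base GG) (w : base HH)
    (a : pi1 v -> pi1 w) : Prop :=
  forall (x : pi1 v) (c : gpath GG), closed_path v c ->
    pi1_val x = path_elt c -> pi1_val (a x) = path_elt (map_path al al' c).

Record finite_decomposition (C : groupType -> Prop) (GG : pgog) :=
    FiniteDecomposition {
  fd_I : Type;
  fd_le : fd_I -> fd_I -> Prop;
  fd_directed : directed_poset fd_le;
  fd_gog : fd_I -> pgog;
  fd_finite : forall i, finite_gog C (fd_gog i);
  fd_tr : forall i j, tot (fd_gog j) -> tot (fd_gog i);
  fd_tr' : forall i j, base (fd_gog j) -> base (fd_gog i);
  fd_tr_morphism : forall i j, fd_le i j ->
    gog_morphism (@fd_tr i j) (@fd_tr' i j);
  fd_proj : forall i, tot GG -> tot (fd_gog i);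
  fd_proj' : forall i, base GG -> base (fd_gog i);
  fd_proj_morphism : forall i, gog_morphism (fd_proj i) (fd_proj' i);
  fd_limit : inverse_limit fd_le fd_tr fd_proj;
  fd_limit' : inverse_limit fd_le fd_tr' fd_proj'
}.

Arguments fd_le {C GG} _ _ _.
Arguments fd_tr {C GG} _ _ _ _.
Arguments fd_tr' {C GG} _ _ _ _.
Arguments fd_proj {C GG} _ _ _.
Arguments fd_proj' {C GG} _ _ _.

(* [P] is Pi_1^C(GG, base GG, v), the inverse limit of the pro-C completions
   [Ph i] of the groups pi_1(GG_i, Gamma_i, v_i). *)
Definition is_Pi1_at (C : groupType -> Prop) (GG : pgog) (v : base GG)
    (P : topGroupType) : Prop :=
  exists (D : finite_decomposition C GG)
    (Ph : fd_I D -> topGroupType)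
    (iota : forall i, pi1 (fd_proj' D i v) -> Ph i)
    (f : forall i j, Ph j -> Ph i) (p : forall i, P -> Ph i),
    [/\ (forall i, is_proC_completion C (iota i)),
        (forall i j, fd_le D i j -> continuous_hom (f i j) /\
           exists a : pi1 (fd_proj' D j v) -> pi1 (fd_proj' D i v),
             induced_map (fd_tr D i j) (fd_tr' D i j) a /\
             (forall x, f i j (iota j x) = iota i (a x))),
        (forall i, is_hom (p i)) &
        inverse_limit (fd_le D) f p].

(* Main.v *)
(* Both groups are determined by their continuous homomorphisms to the groups H
   of C, so it suffices to match Hom(P, H) with Hom(Q, H) naturally in H.

   By compactness a homomorphism P -> H is given, at some finite level i, by a
   homomorphism pi_1(G_i, Gamma_i, v_i) -> H; conjugating with chosen paths from
   v_i extends it to F(G_i, Gamma_i), that is, to values on vertex groups and on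
   edges. Pulled back to (G, Gamma), the values on edges are a cocycle t with
   values in the finite group H. On the universal covering t is a coboundary:
   a component of the covering of it twisted by t is a connected Galois
   covering, hence trivial, and so is the graph of a solution u. The restriction
   of u to the 0-section is a gauge turning the data into a J-specialisation,
   whence a homomorphism Q -> H. Conversely a J-specialisation in H is locally
   constant and therefore lives on a finite level, where it restricts to
   pi_1(G_i, Gamma_i, v_i). Two homomorphisms of F(G_i, Gamma_i) agreeing on
   pi_1 differ by a gauge that is 1 at v_i, and connectedness of the universal
   covering forces this gauge to be 1 for two J-specialisations. *)

Require Import Defs.
From HB Require Import structures.
From mathcomp Require Import finmap all_boot.
From mathcomp Require Import all_classical.
From mathcomp Require Import topology.

Set Implicit Arguments.
Unset Strict Implicit.
Unset Printing Implicit Defensive.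

Local Open Scope classical_set_scope.
Local Open Scope group_scope.

(** The groups H carry the discrete topology, so continuity becomes local constancy and every
    topological claim reduces to compactness. The recurring obstacle is that the projections of (G,
    Gamma) to its finite levels need not be surjective and may collapse edges to vertices, so an
    identity valid in the limit can fail at the level where its data live. The remedy is always the
    same: the failures at the various levels form closed sets that the transition maps preserve, and
    a thread of failures would be a failure in the limit, so beyond some level there are none. The
    gauge is normalised to 1 at v because then the homomorphism on pi_1, hence on P, is unchanged by
    it. Finiteness of H supplies the component of the twisted covering: among the clopen unions of
    components, one with a minimal fibre exists. The covering group acts by left multiplication and
    the cocycle by right multiplication, so the two commute. *)

Definition locally_constant (T : topologicalType) (S : Type) (f : T -> S) :=
  forall x, \forall y \near x, f y = f x.

(** * Locally constant maps and compact Hausdorff spaces *)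

Section LocallyConstant.
Variables (T U : topologicalType) (S S' : Type).

Lemma locally_constant_cst (s : S) : locally_constant (fun _ : T => s).
Proof. by move=> x; apply: nearW. Qed.

Lemma locally_constant_post (f : T -> S) (g : S -> S') :
  locally_constant f -> locally_constant (fun x => g (f x)).
Proof. by move=> lf x; apply: filterS (lf x) => y ->. Qed.

Lemma locally_constant_pre (f : U -> T) (g : T -> S) :
  continuous f -> locally_constant g -> locally_constant (fun x => g (f x)).
Proof. by move=> cf lg x; have := cf x _ (lg (f x)). Qed.

Lemma locally_constant_pair (f : T -> S) (g : T -> S') :
  locally_constant f -> locally_constant g ->
  locally_constant (fun x => (f x, g x)).
Proof. by move=> lf lg x; apply: filterS2 (lf x) (lg x) => y -> ->. Qed.

Lemma locally_constant_open (f : T -> S) (A : set S) :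
  locally_constant f -> open [set x | A (f x)].
Proof.
move=> lf; rewrite openE => x /= Ax; apply: filterS (lf x) => y /= ->.
exact: Ax.
Qed.

Lemma locally_constant_closed (f : T -> S) (A : set S) :
  locally_constant f -> closed [set x | A (f x)].
Proof.
by move=> lf; rewrite -openC; exact: (@locally_constant_open f (~` A)).
Qed.

Lemma open_locally_constant (f : T -> S) :
  (forall s, open [set x | f x = s]) -> locally_constant f.
Proof. by move=> h x; apply: open_nbhs_nbhs; split=> //; exact: h. Qed.

End LocallyConstant.

Lemma locally_constantP (T : topologicalType) (S : choiceType)
    (f : T -> discrete_topology S) : continuous f <-> locally_constant f.
Proof.
split=> [cf x|lf x A].
  by apply: (cf x [set f x]); exact: (@discrete_set1 (discrete_topology S)).
move=> /nbhs_singleton Ax; apply: filterS (lf x) => y /= ->; exact: Ax.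
Qed.

Lemma locally_constant_bool (T : topologicalType) (A : set T) :
  clopen A -> locally_constant (fun x => `[< A x >]).
Proof.
move=> [oA cA] x; have [Ax|Ax] := pselect (A x).
  by apply: filterS (open_nbhs_nbhs (conj oA Ax)) => y Ay; rewrite !asboolT.
have Cx : nbhs x (~` A) by apply: open_nbhs_nbhs; split=> //; exact: closed_openC.
by apply: filterS Cx => y Ay; rewrite !asboolF.
Qed.

Lemma zero_dimensional_hausdorff (T : topologicalType) :
  zero_dimensional T -> hausdorff_space T.
Proof.
move=> zd; rewrite open_hausdorff => x y /zd [A [[oA cA] Ax Ay]].
exists (A, ~` A); split; rewrite ?inE //=.
- exact: closed_openC.
- by rewrite setICr.
Qed.

Lemma finite_hausdorff_closed (T : topologicalType) (A : set T) :
  finite_set [set: T] -> hausdorff_space T -> closed A.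
Proof.
move=> fT hT; have := hausdorff_accessible hT.
rewrite accessible_finite_set_closed; apply.
exact: (sub_finite_set (@subsetT _ _) fT).
Qed.

Lemma finite_hausdorff_locally_constant (T : topologicalType) (S : Type)
    (f : T -> S) :
  finite_set [set: T] -> hausdorff_space T -> locally_constant f.
Proof.
move=> fT hT; apply: open_locally_constant => s; rewrite -closedC.
exact: finite_hausdorff_closed.
Qed.

Lemma continuous_pair (T U V : topologicalType) (f : T -> U) (g : T -> V) :
  continuous f -> continuous g -> continuous (fun x => (f x, g x)).
Proof. by move=> cf cg x; apply: cvg_pair; [exact: cf|exact: cg]. Qed.

Lemma continuous_then (T U V : topologicalType) (f : T -> U) (g : U -> V) :
  continuous f -> continuous g -> continuous (fun x => g (f x)).
Proof. by move=> cf cg x; apply: continuous_comp; [exact: cf|exact: cg]. Qed.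

Lemma continuous_fst (T U : topologicalType) : continuous (@fst T U).
Proof. by move=> x; exact: cvg_fst. Qed.

Lemma continuous_snd (T U : topologicalType) : continuous (@snd T U).
Proof. by move=> x; exact: cvg_snd. Qed.

Lemma hausdorff_prod (T U : topologicalType) :
  hausdorff_space T -> hausdorff_space U -> hausdorff_space (T * U)%type.
Proof.
move=> hT hU [x1 x2] [y1 y2] xy; congr pair.
- apply: hT => A B Ax By.
  have nA : nbhs (x1, x2) (fst @^-1` A) by exact: (@cvg_fst _ _ (nbhs x1) (nbhs x2)).
  have nB : nbhs (y1, y2) (fst @^-1` B) by exact: (@cvg_fst _ _ (nbhs y1) (nbhs y2)).
  by have [z [? ?]] := xy _ _ nA nB; exists z.1.
- apply: hU => A B Ax By.
  have nA : nbhs (x1, x2) (snd @^-1` A) by exact: (@cvg_snd _ _ (nbhs x1) (nbhs x2)).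
  have nB : nbhs (y1, y2) (snd @^-1` B) by exact: (@cvg_snd _ _ (nbhs y1) (nbhs y2)).
  by have [z [? ?]] := xy _ _ nA nB; exists z.2.
Qed.

Lemma compact_setTX (T U : topologicalType) :
  compact [set: T] -> compact [set: U] -> compact [set: T * U].
Proof. by move=> cT cU; rewrite -setXTT; exact: compact_setX. Qed.

Lemma closed_eq (T U : topologicalType) (f g : T -> U) :
  hausdorff_space U -> continuous f -> continuous g ->
  closed [set x | f x = g x].
Proof.
move=> hU cf cg x clx; apply: hU => A B fA gB.
have fA' : nbhs x (f @^-1` A) by exact: cf.
have gB' : nbhs x (g @^-1` B) by exact: cg.
have [y [/= e [Ay By]]] := clx _ (filterI fA' gB').
by exists (f y); split=> //; rewrite e.
Qed.

(** The preimage of a closed set is the projection of a compact part of the graph, hence closed. *)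
Lemma closed_graph_continuous (T U : topologicalType) (f : T -> U) :
  hausdorff_space T -> compact [set: T] -> compact [set: U] ->
  closed [set p : T * U | f p.1 = p.2] -> continuous f.
Proof.
move=> hT cT cU cG; apply/continuous_closedP => A cA.
have -> : f @^-1` A = fst @` ([set p : T * U | f p.1 = p.2] `&` snd @^-1` A).
  apply/seteqP; split=> [x Ax|x [[y z] [/= e Az] <-]] /=.
    by exists (x, f x).
  by rewrite e.
apply: compact_closed => //; apply: continuous_compact.
  by apply: continuous_subspaceT => p; exact: cvg_fst.
apply: (subclosed_compact _ (compact_setTX cT cU)) => //.
apply: closedI => //; apply: preimage_closed => // p _; exact: cvg_snd.
Qed.

Lemma ultra_compact_cvg (A : Type) (T : topologicalType) (f : A -> T)
    (F : set_system A) :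
  UltraFilter F -> compact [set: T] -> exists x : T, f @ F --> x.
Proof.
move=> uF cT.
have [x [_ clx]] := cT (f @ F) _ (filterT : (f @ F) setT).
exists x => V Vx; have [//|FV] := in_ultra_setVsetC (f @^-1` V) uF.
have [y [/= yV]] : (~` V) `&` V !=set0 by apply: clx.
by move/yV.
Qed.

(** * Inverse limits of compact spaces *)

Lemma inverse_system_prod (I : Type) (le : I -> I -> Prop)
    (X Y : I -> topologicalType) (phi : forall i j, X j -> X i)
    (psi : forall i j, Y j -> Y i) :
  inverse_system le phi -> inverse_system le psi ->
  inverse_system le (X := fun i => (X i * Y i)%type)
    (fun i j z => (phi i j z.1, psi i j z.2)).
Proof.
move=> sX sY; split=> [i j ij z|i [x y]|i j k ij jk [x y]] /=.
- apply: cvg_pair.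
    by apply: (cvg_comp _ _ cvg_fst); exact: (sys_continuous sX ij).
  by apply: (cvg_comp _ _ cvg_snd); exact: (sys_continuous sY ij).
- by rewrite (sys_id sX) (sys_id sY).
- by rewrite (sys_comp sX) // (sys_comp sY).
Qed.

Section InverseSystem.
Variables (I : Type) (le : I -> I -> Prop).
Hypothesis dI : directed_poset le.
Variables (X : I -> topologicalType) (phi : forall i j, X j -> X i).
Arguments phi : clear implicits.
Hypothesis sysX : inverse_system le phi.
Hypothesis cX : forall i, compact [set: X i].
Hypothesis hX : forall i, hausdorff_space (X i).

(** An ultrafilter on the full product that contains every [Z j] has a limit in each coordinate.
    Each limit lies in the closed set [W i], and the limits form a thread because the transition
    maps are continuous and the spaces Hausdorff. *)
Lemma compatible_family (W : forall i, set (X i)) :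
  (forall i, closed (W i)) -> (forall i, W i !=set0) ->
  (forall i j, le i j -> forall x, W j x -> W i (phi i j x)) ->
  exists x : forall i, X i, (forall i, W i (x i)) /\
    (forall i j, le i j -> phi i j (x j) = x i).
Proof.
move=> cW nW sW.
pose Z j := [set x : forall i, X i | forall i, le i j ->
  W i (x i) /\ phi i j (x j) = x i].
have ZI i j : exists k, Z k `<=` Z i `&` Z j.
  have [k [ik jk]] := dp_directed dI i j.
  exists k => x Zx; split=> l lI.
    have [? e] := Zx l (dp_trans dI lI ik); split=> //.
    by have [_ <-] := Zx i ik; rewrite (sys_comp sysX).
  have [? e] := Zx l (dp_trans dI lI jk); split=> //.
  by have [_ <-] := Zx j jk; rewrite (sys_comp sysX).
have [i0] := dp_inhabited dI.
have FZ : ProperFilter (filter_from setT Z).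
  apply: filter_from_proper.
    apply: filter_from_filter; first by exists i0.
    by move=> i j _ _; have [k] := ZI i j; exists k.
  move=> j _; have [y Wy] := nW j.
  (* [Z j] constrains only the coordinates below [j]; the others may be filled arbitrarily. *)
  pose w i := projT1 (cid (nW i)).
  exists (fun i => if pselect (le i j) is left _ then phi i j y else w i).
  move=> i ij; case: pselect => // _; split; first exact: sW.
  by case: pselect => [_|[]]; rewrite ?(sys_id sysX) //; exact: (dp_refl dI).
have [U [uU FU]] := ultraFilterLemma FZ.
pose lx i := cid (ultra_compact_cvg (fun x : forall i, X i => x i) uU (@cX i)).
exists (fun i => projT1 (lx i)); split=> [i|i j ij].
  apply: (closed_cvg _ (cW i) _ _ (projT2 (lx i))).
  apply: FU; exists i => // x Zx.
  exact: (Zx i (dp_refl dI _)).1.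
apply: (cvg_unique (@hX i) _ (projT2 (lx i))).
have h := cvg_comp _ _ (projT2 (lx j)) (sys_continuous sysX ij (x := projT1 (lx j))).
apply: cvg_trans h => A /= UA.
suff : U [set x : forall i, X i | phi i j (x j) = x i].
  by move=> /(filterI UA) UB; apply: filterS UB => x [/= Ax e]; move: Ax; rewrite /preimage /= e.
apply: FU; exists j => // x Zx /=; exact: (Zx i ij).2.
Qed.

(** The tool for passing from the limit to a finite level: [W i] is meant to be the set of points of
    [X i] where some identity fails. If it were non-empty at all levels above [i0],
    [compatible_family] would give a thread of failures. *)
Lemma eventually_empty (i0 : I) (W : forall i, set (X i)) :
  (forall i, le i0 i -> closed (W i)) ->
  (forall i j, le i0 i -> le i j -> forall x, W j x -> W i (phi i j x)) ->
  (forall x : forall i, X i, (forall i j, le i j -> phi i j (x j) = x i) ->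
     exists2 i, le i0 i & ~ W i (x i)) ->
  exists2 i, le i0 i & forall x, ~ W i x.
Proof.
move=> cW sW hx; apply: contrapT => h.
(* Indices not above [i0] get the whole space, so that the family is defined over all of [I]. *)
pose W' i := [set x | le i0 i -> W i x].
have [|||x [Wx ex]] := @compatible_family W'.
- move=> i; have [h0|h0] := pselect (le i0 i).
    suff -> : W' i = W i by exact: cW.
    by apply/seteqP; split=> x Wx; [exact: Wx|move=> _].
  suff -> : W' i = setT by exact: closedT.
  by apply/seteqP; split=> x _.
- move=> i; have [k [ik0 ik]] := dp_directed dI i0 i.
  have [x Wx] : W k !=set0.
    by apply: contrapT => h1; apply: h; exists k => // x Wx; apply: h1; exists x.
  by exists (phi i k x) => h0; exact: sW.
- move=> i j ij x Wj h0; apply: sW => //; apply: Wj; exact: dp_trans h0 ij.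
have [i h0] := hx x ex; apply; exact: Wx.
Qed.

Variables (L : topologicalType) (p : forall i, L -> X i).
Hypothesis limL : inverse_limit le phi p.

(** Maps from a one-point space are points, so the universal property identifies the points of [L]
    with the threads. *)
Let point := discrete_topology unit.

Lemma limit_separated x y : (forall i, p i x = p i y) -> x = y.
Proof.
move=> e; pose q i (_ : point) := p i x.
have [|u [_ uu]] := il_universal limL (Y := point) (q := q).
  split=> [i|i j ij z]; [exact: cst_continuous|exact: (il_cone limL).2].
have cq (l : L) : continuous (fun _ : point => l) by exact: cst_continuous.
have ex := uu (fun=> x) (conj (cq x) (fun i _ => erefl)).
have ey := uu (fun=> y) (conj (cq y) (fun i _ => esym (e i))).
by have := congr1 (fun f => f tt) (etrans (esym ex) ey).
Qed.

Lemma limit_of_compatible (x : forall i, X i) :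
  (forall i j, le i j -> phi i j (x j) = x i) -> exists l, forall i, p i l = x i.
Proof.
move=> e; have [|u [[_ hu] _]] :=
    il_universal limL (Y := point) (q := fun i _ => x i).
  by split=> [i|i j ij z]; [exact: cst_continuous|exact: e].
by exists (u tt) => i; exact: hu.
Qed.

Lemma limit_compact : compact [set: L].
Proof.
rewrite compact_ultra => F uF _.
pose lx i := cid (ultra_compact_cvg (p i) uF (@cX i)).
have ex i j : le i j -> phi i j (projT1 (lx j)) = projT1 (lx i).
  move=> ij; apply: (cvg_unique (@hX i) _ (projT2 (lx i))).
  have h := cvg_comp _ _ (projT2 (lx j)) (sys_continuous sysX ij (x := projT1 (lx j))).
  apply: cvg_trans h => A /= UA.
  rewrite /nbhs /= in UA *; apply: filterS UA => l /=.
  by rewrite (il_cone limL).2.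
have [l hl] := limit_of_compatible ex; exists l; split=> //.
(* The initial topology along the projections makes [L] a cone, so by the
   universal property it is finer than the given topology. *)
pose L' := sup_topology (fun i => Topological.class (initial_topology (p i))).
have [|u [[cu hu] _]] := il_universal limL (Y := L') (q := p).
  split; last exact: (il_cone limL).2.
  move=> i x A Ax.
  have h := iffLR (cvg_sup _ x (nbhs_filter (x : L'))) (@cvg_id _ _) i.
  by apply: h; exact: (@initial_continuous _ _ (p i) x).
have ue x : u x = x by apply: limit_separated => i; exact: hu.
have Fl : F --> (l : L').
  apply/cvg_sup => i A [B [[V oV <-] Vl] BA].
  rewrite nbhs_filterE; apply: filterS BA _.
  by apply: (projT2 (lx i)); apply: open_nbhs_nbhs; split=> //; rewrite -hl.
move=> A Al; have h : nbhs (l : L') (u @^-1` A) by apply: cu; rewrite ue.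
by apply: filterS (Fl _ h) => x /=; rewrite /preimage /= ue.
Qed.

End InverseSystem.

(** The pairs separated by [h] form a compact set. Each of them is separated by some [q a], which
    also separates all nearby pairs, and directedness merges finitely many indices into one. *)
Lemma directed_family_refines (L : topologicalType) (A R S : Type)
    (q : A -> L -> R) (h : L -> S) :
  compact [set: L] -> inhabited A ->
  (forall a b, exists c, forall x y, q c x = q c y ->
     q a x = q a y /\ q b x = q b y) ->
  (forall a, locally_constant (q a)) ->
  (forall x y, (forall a, q a x = q a y) -> x = y) ->
  locally_constant h ->
  exists a, forall x y, q a x = q a y -> h x = h y.
Proof.
move=> cL [a0] dq lq sq lh.
pose W := [set z : L * L | h z.1 <> h z.2].
have cW : compact W.
  apply: (subclosed_compact _ (compact_setTX cL cL)) => //.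
  have lW : locally_constant (fun z : L * L => (h z.1, h z.2)).
    apply: locally_constant_pair.
      by apply: (locally_constant_pre (f := fst)) lh => z; exact: cvg_fst.
    by apply: (locally_constant_pre (f := snd)) lh => z; exact: cvg_snd.
  exact: (@locally_constant_closed _ _ _ (fun s => s.1 <> s.2) lW).
(* These tails generate the filter of sufficiently fine indices, along which the covering form of
   compactness is applied. *)
pose refines a := [set b | forall x y, q b x = q b y -> q a x = q a y].
have FF : Filter (filter_from setT refines).
  apply: filter_from_filter; first by exists a0.
  move=> a b _ _; have [c hc] := dq a b.
  by exists c => // d dc; split=> x y /dc /hc [].
have /= h1 := iffLR (compact_near_coveringP W) cW _ _
  (fun a z => q a z.1 <> q a z.2) FF.
have [|a _ ha] := h1.
  move=> [x y] /= hxy.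
  have [a qa] : exists a, q a x <> q a y.
    apply: contrapT => /forallNP na; apply: hxy; congr h; apply: sq => a.
    by apply: contrapT; exact: na.
  exists ([set z : L * L | q a z.1 = q a x /\ q a z.2 = q a y], refines a).
    split=> /=; last by exists a.
    by exists ([set z | q a z = q a x], [set z | q a z = q a y]) => //=; split; exact: lq.
  move=> [[x' y'] b] [/= [ex ey] rb] e; apply: qa.
  by rewrite -ex -ey; exact: rb.
exists a => x y qxy; apply: contrapT => hxy.
by have := ha a (fun x y e => e) (x, y) hxy; apply.
Qed.

Section Factor.
Variables (I : Type) (le : I -> I -> Prop).
Hypothesis dI : directed_poset le.
Variables (X : I -> topologicalType) (phi : forall i j, X j -> X i).
Arguments phi : clear implicits.
Hypothesis cX : forall i, compact [set: X i].
Hypothesis zX : forall i, zero_dimensional (X i).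
Variables (L : topologicalType) (p : forall i, L -> X i).
Hypothesis limL : inverse_limit le phi p.

Let hX i : hausdorff_space (X i) := zero_dimensional_hausdorff (@zX i).

Lemma limit_zero_dimensional : zero_dimensional L.
Proof.
move=> x y /eqP xy.
have [i /eqP pi] : exists i, p i x <> p i y.
  apply: contrapT => /forallNP na; apply: xy.
  by apply: (limit_separated limL) => i; apply: contrapT; exact: na.
have [A [cA Ax Ay]] := zX pi; exists (p i @^-1` A); split=> //.
exact: (preimage_clopen cA ((il_cone limL).1 i)).
Qed.

Lemma limit_locally_constant (S : Type) (s0 : S) (h : L -> S) :
  locally_constant h ->
  exists i (g : X i -> S), locally_constant g /\ (forall l, h l = g (p i l)).
Proof.
move=> lh; have cL := limit_compact (il_system limL) cX hX limL.
(* A single target type is needed for all indices; [nat] is enough, since clopen sets are coded by 0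
   and 1 and pairs of codes are recoded by [pickle]. *)
pose A := {i : I & {g : X i -> nat | locally_constant g}}.
pose q (a : A) (l : L) := sval (projT2 a) (p (projT1 a) l).
have [i0] := dp_inhabited dI.
have [||||| [i [g lg]] /= hg] := @directed_family_refines L A nat S q h cL.
- by apply: inhabits; exists i0, (fun=> 0); exact: locally_constant_cst.
- move=> [i [g lg]] [j [g' lg']]; have [k [ik jk]] := dp_directed dI i j.
  have ck l : le l k -> continuous (phi l k) := sys_continuous (il_system limL) (j := k).
  have lG := locally_constant_post pickle (locally_constant_pair
    (locally_constant_pre (ck i ik) lg) (locally_constant_pre (ck j jk) lg')).
  exists (existT _ k (exist _ _ lG)) => x y.
  rewrite /q /= => /(pcan_inj pickleK).
  by rewrite !(il_cone limL).2 // => -[].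
- by move=> [i [g lg]]; exact: (locally_constant_pre ((il_cone limL).1 i) lg).
- move=> x y e; apply: (limit_separated limL) => i; apply: contrapT => /eqP /zX.
  move=> [U [cU Ux Uy]]; case: Uy.
  have lU := locally_constant_post nat_of_bool (locally_constant_bool cU).
  have := e (existT _ i (exist _ _ lU)); rewrite /q /=.
  by rewrite asboolT //; case: asboolP.
- exact: lh.
(* The default [s0] serves the values not attained on the image of [L], as [p i] need not be
   surjective. *)
pose g' x := if pselect (exists l, g (p i l) = x) is left e then h (projT1 (cid e)) else s0.
exists i, (fun x => g' (g x)); split; first exact: locally_constant_post.
move=> l; rewrite /g'; case: pselect => [e|]; last by case; exists l.
by apply: hg; rewrite /q /=; case: cid.
Qed.
End Factor.

(** * Discrete groups and factorisation of homomorphisms through a level *)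

HB.instance Definition _ (K : groupType) := Group.copy (discrete_topology K) K.

Section DiscreteGroup.
Variable K : groupType.

Fact discrete_mulg_continuous :
  continuous (fun p : discrete_topology K * discrete_topology K => p.1 * p.2).
Proof.
apply/(@locally_constantP _ K) => -[x y].
exists ([set x], [set y]); first by split; apply: (@discrete_set1 (discrete_topology K)).
by move=> [x' y'] /= [-> ->].
Qed.

Fact discrete_invg_continuous :
  continuous (fun x : discrete_topology K => x^-1).
Proof.
have lid : locally_constant (id : discrete_topology K -> K).
  by apply/(@locally_constantP _ K) => x; exact: cvg_id.
apply/(@locally_constantP _ K).
exact: (@locally_constant_post _ _ _ _ (fun y : K => y^-1) lid).
Qed.

HB.instance Definition _ := isTopGroup.Build (discrete_topology K)
  discrete_mulg_continuous discrete_invg_continuous.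

End DiscreteGroup.

Lemma hom1 (G H : groupType) (f : G -> H) : is_hom f -> f 1 = 1.
Proof. by move=> hf; apply: (mulgI (f 1)); rewrite -hf !mulg1. Qed.

Lemma homV (G H : groupType) (f : G -> H) x : is_hom f -> f x^-1 = (f x)^-1.
Proof.
by move=> hf; apply: (mulgI (f x)); rewrite -hf !mulgV hom1.
Qed.

Lemma hom_comp (G H K : groupType) (f : G -> H) (g : H -> K) :
  is_hom f -> is_hom g -> is_hom (fun x => g (f x)).
Proof. by move=> hf hg x y; rewrite hf hg. Qed.

Section FactorHom.
Variables (I : Type) (le : I -> I -> Prop).
Hypothesis dI : directed_poset le.
Variables (X : I -> topGroupType) (phi : forall i j, X j -> X i).
Arguments phi : clear implicits.
Hypothesis cX : forall i, compact [set: X i].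
Hypothesis zX : forall i, zero_dimensional (X i).
Variables (L : topGroupType) (p : forall i, L -> X i).
Hypothesis limL : inverse_limit le phi p.
Hypothesis hphi : forall i j, le i j -> is_hom (phi i j).
Hypothesis hp : forall i, is_hom (p i).

Lemma limit_hom_factor (H : groupType) (h : L -> H) :
  locally_constant h -> is_hom h ->
  exists i (g : X i -> H),
    [/\ locally_constant g, is_hom g & forall l, h l = g (p i l)].
Proof.
move=> lh hh; have hX i := zero_dimensional_hausdorff (@zX i).
have [i [g [lg eg]]] := limit_locally_constant dI cX zX limL 1 lh.
have sX := il_system limL.
(* The pairs on which the factor [g] fails to be multiplicative. No thread of such pairs exists: it
   would come from a pair in [L], where [h] is multiplicative. *)
pose W j : set (X j * X j) := [set z | g (phi i j (z.1 * z.2)) <>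
   g (phi i j z.1) * g (phi i j z.2)].
have [|||||j ij nW] := @eventually_empty _ _ dI _ _ (inverse_system_prod sX sX) _ _ i W.
- by move=> j; apply: compact_setTX.
- by move=> j; apply: hausdorff_prod.
- move=> j ij; have cj := sys_continuous sX ij.
  have l1 : locally_constant (fun z : X j * X j => g (phi i j (z.1 * z.2))).
    by apply: locally_constant_pre lg => z; apply: (cvg_comp _ _ (@mulg_continuous (X j) z)); exact: cj.
  have l2 : locally_constant (fun z : X j * X j => g (phi i j z.1)).
    by apply: locally_constant_pre lg => z; apply: (cvg_comp _ _ cvg_fst); exact: cj.
  have l3 : locally_constant (fun z : X j * X j => g (phi i j z.2)).
    by apply: locally_constant_pre lg => z; apply: (cvg_comp _ _ cvg_snd); exact: cj.
  exact: (@locally_constant_closed _ _ _ (fun s => s.1.1 <> s.1.2 * s.2)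
    (locally_constant_pair (locally_constant_pair l1 l2) l3)).
- move=> j k ij jk [x y] /=; rewrite /W /=.
  by rewrite -(hphi jk) !(sys_comp sX).
- move=> x ex; exists i; first exact: (dp_refl dI).
  have [l1 e1] := limit_of_compatible limL (fun i j ij => congr1 fst (ex i j ij)).
  have [l2 e2] := limit_of_compatible limL (fun i j ij => congr1 snd (ex i j ij)).
  apply; rewrite /= !(sys_id sX) -e1 -e2 -hp -!eg; exact: hh.
exists j, (fun x => g (phi i j x)); split=> [|x y|l].
- exact: (locally_constant_pre (sys_continuous sX ij) lg).
- by apply: contrapT => h1; apply: (nW (x, y)).
- by rewrite (il_cone limL).2.
Qed.

End FactorHom.

Definition lc_hom (L : topGroupType) (H : groupType) (f : L -> H) :=
  locally_constant f /\ is_hom f.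

Lemma lc_hom_post (L : topGroupType) (H K : groupType) (f : L -> H) (g : H -> K) :
  lc_hom f -> is_hom g -> lc_hom (fun x => g (f x)).
Proof.
by move=> [lf hf] hg; split; [exact: locally_constant_post|exact: hom_comp].
Qed.

Lemma lc_hom_pre (L M : topGroupType) (H : groupType) (f : L -> M) (g : M -> H) :
  continuous_hom f -> lc_hom g -> lc_hom (fun x => g (f x)).
Proof.
move=> [cf hf] [lg hg]; split; [exact: locally_constant_pre lg|exact: hom_comp].
Qed.

(** * Homomorphisms to groups in the class *)

(* [L] is the limit of its continuous homomorphisms to groups in [C]: maps
   into [L] are the same as natural families of maps into those groups. *)
Definition residually_determined (C : groupType -> Prop) (L : topGroupType) :=
  forall (Y : topologicalType) (theta : forall H : groupType, (L -> H) -> Y -> H),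
  (forall (H : groupType) (f : L -> H), C H -> lc_hom f ->
     locally_constant (theta H f)) ->
  (forall (H K : groupType) (f : L -> H) (g : H -> K), C H -> C K ->
     lc_hom f -> is_hom g ->
     theta K (fun x => g (f x)) = fun y => g (theta H f y)) ->
  exists! u : Y -> L, continuous u /\
    (forall (H : groupType) (f : L -> H), C H -> lc_hom f ->
       theta H f = fun y => f (u y)).

Lemma residually_separated C (L : topGroupType) (x y : L) :
  residually_determined C L ->
  (forall (H : groupType) (f : L -> H), C H -> lc_hom f -> f x = f y) -> x = y.
Proof.
move=> rd e; pose point := discrete_topology unit.
have [||u [_ uu]] := rd point (fun H f _ => f x).
- by move=> *; exact: locally_constant_cst.
- by [].
have cq (l : L) : continuous (fun _ : point => l) by exact: cst_continuous.
have ex := uu (fun=> x) (conj (cq x) (fun H f _ _ => erefl)).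
have ey : u = fun=> y.
  apply: uu; split; first exact: cq.
  by move=> H f CH lf; apply/funext => _; exact: e.
by have := congr1 (fun f => f tt) (etrans (esym ex) ey).
Qed.

Section FiniteClass.
Variable C : groupType -> Prop.
Hypothesis hC : extension_closed_class C.

Lemma class_compact (K : groupType) :
  C K -> compact [set: discrete_topology K].
Proof. by move=> CK; apply: finite_compact; exact: (class_finite hC CK). Qed.

Section FiniteLimit.
Variables (I : Type) (le : I -> I -> Prop).
Hypothesis dI : directed_poset le.
Variables (K : I -> groupType) (phi : forall i j, K j -> K i).
Arguments phi : clear implicits.
Hypothesis CK : forall i, C (K i).
Variables (L : topGroupType) (p : forall i, L -> K i).
Hypothesis hphi : forall i j, le i j -> is_hom (phi i j).
Hypothesis hp : forall i, is_hom (p i).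
Hypothesis limL :
  @inverse_limit I le (fun i => discrete_topology (K i)) phi L p.

Lemma finite_limit_lc_hom i : lc_hom (p i).
Proof.
split; last exact: hp.
exact: (iffLR (@locally_constantP _ (K i) (p i)) ((il_cone limL).1 i)).
Qed.

Lemma finite_limit_compact : compact [set: L].
Proof.
apply: (limit_compact (il_system limL) _ _ limL) => i; first exact: class_compact.
exact: discrete_hausdorff.
Qed.

Lemma finite_limit_zero_dimensional : zero_dimensional L.
Proof.
apply: (limit_zero_dimensional _ limL) => i.
exact: discrete_zero_dimension.
Qed.

Lemma finite_limit_hom_factor (H : groupType) (h : L -> H) : lc_hom h ->
  exists i (g : K i -> H), is_hom g /\ (forall l, h l = g (p i l)).
Proof.
move=> [lh hh].
have [||||i [g [_ hg e]]] := @limit_hom_factor I le dI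
  (fun i => discrete_topology (K i)) phi _ _ L p limL _ _ H h lh hh.
- by move=> i; exact: class_compact.
- by move=> i; exact: discrete_zero_dimension.
- by [].
- by [].
by exists i, g.
Qed.

(** By naturality the values of [theta] at the projections [p i] form a cone, and they determine all
    the others because every homomorphism to a group of the class factors through some [p i]. *)
Lemma finite_limit_determined : residually_determined C L.
Proof.
move=> Y theta ltheta ntheta.
have lp := finite_limit_lc_hom.
have [|u [[cu hu] uu]] := il_universal limL (Y := Y) (q := fun i => theta (K i) (p i)).
  split=> [i|i j ij y].
    by apply/(@locally_constantP _ (K i)); exact: (ltheta (K i) (p i) (CK i) (lp i)).
  have e : (fun x => phi i j (p j x)) = p i.
    by apply/funext => x; exact: (il_cone limL).2.
  by rewrite -e (ntheta _ _ _ _ (CK j) (CK i) (lp j) (hphi ij)).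
exists u; split.
  split=> // H f CH lf; have [i [g [hg e]]] := finite_limit_hom_factor lf.
  have -> : f = fun x => g (p i x) by exact/funext.
  by rewrite ntheta //; apply/funext => y; rewrite hu.
move=> u' [cu' hu']; apply: uu; split=> // i y.
by rewrite (hu' (K i) (p i)).
Qed.

End FiniteLimit.

Lemma proC_compact (L : topGroupType) : is_proC C L -> compact [set: L].
Proof.
move=> [I [le [K [phi [p [[dI CK] hphi hp limL]]]]]].
exact: (finite_limit_compact CK limL).
Qed.

Lemma proC_determined (L : topGroupType) :
  is_proC C L -> residually_determined C L.
Proof.
move=> [I [le [K [phi [p [[dI CK] hphi hp limL]]]]]].
exact: (finite_limit_determined dI CK hphi hp limL).
Qed.

Lemma proC_discrete (K : groupType) : C K -> is_proC C (discrete_topology K).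
Proof.
move=> CK; exists unit, (fun _ _ => True), (fun=> K), (fun _ _ => id), (fun _ => id).
split=> //.
  split=> //.
  by split; [exact: (inhabits tt)| |move=> [] []| |move=> i j; exists i].
split.
- by split=> // i j _ x; exact: cvg_id.
- by split=> // i x; exact: cvg_id.
- move=> Y q [cq _]; exists (q tt); split.
      by split=> [|[] y]; [exact: cq|].
    by move=> u [_ hu]; apply/funext => y; rewrite (hu tt).
Qed.

Section LimitDetermined.
Variables (I : Type) (le : I -> I -> Prop).
Hypothesis dI : directed_poset le.
Variables (X : I -> topGroupType) (phi : forall i j, X j -> X i).
Arguments phi : clear implicits.
Hypothesis cX : forall i, compact [set: X i].
Hypothesis zX : forall i, zero_dimensional (X i).
Hypothesis rX : forall i, residually_determined C (X i).
Variables (L : topGroupType) (p : forall i, L -> X i).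
Hypothesis limL : inverse_limit le phi p.
Hypothesis hphi : forall i j, le i j -> is_hom (phi i j).
Hypothesis hp : forall i, is_hom (p i).

(** The family [theta] induces a map to each [X i]; these maps are compatible because homomorphisms
    to the class separate the points of [X i]. For a limit of completions this avoids rewriting it
    as a single limit of finite groups. *)
Lemma limit_determined : residually_determined C L.
Proof.
move=> Y theta ltheta ntheta.
have cp i : continuous_hom (p i) by split; [exact: (il_cone limL).1|].
have cphi i j : le i j -> continuous_hom (phi i j).
  by move=> ij; split; [exact: (sys_continuous (il_system limL) ij)|exact: hphi].
have E i := rX (theta := fun H f => theta H (fun x => f (p i x)))
  (fun H f CH lf => ltheta H _ CH (lc_hom_pre (cp i) lf))
  (fun H K f g CH CK lf hg => ntheta H K _ g CH CK (lc_hom_pre (cp i) lf) hg).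
pose u i := projT1 (cid (E i)).
have [cu hu] : (forall i, continuous (u i)) /\
    (forall i (H : groupType) (f : X i -> H), C H -> lc_hom f ->
      theta H (fun x => f (p i x)) = fun y => f (u i y)).
  by split=> i; have [[cu hu] _] := projT2 (cid (E i)).
have [|w [[cw hw] uw]] := il_universal limL (Y := Y) (q := u).
  split=> // i j ij y; apply: (residually_separated (@rX i)) => H f CH lf.
  have := congr1 (@^~ y) (hu i H f CH lf) => /= <-.
  have := congr1 (@^~ y) (hu j H _ CH (lc_hom_pre (cphi i j ij) lf)) => /= <-.
  by congr (theta _ _ y); apply/funext => x; rewrite (il_cone limL).2.
exists w; split.
  split=> // H f CH [lf hf].
  have [i [g [lg hg e]]] := limit_hom_factor dI cX zX limL hphi hp lf hf.
  have -> : f = fun x => g (p i x) by exact/funext.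
  by rewrite hu //; apply/funext => y; rewrite hw.
move=> w' [cw' hw']; apply: uw; split=> // i y.
apply: (residually_separated (@rX i)) => H f CH lf.
have := congr1 (@^~ y) (hw' H _ CH (lc_hom_pre (cp i) lf)) => /= <-.
by rewrite hu.
Qed.

End LimitDetermined.
End FiniteClass.

Section Transfer.
Variables (C : groupType -> Prop) (P Q : topGroupType).
Variable R : forall H : groupType, (P -> H) -> (Q -> H) -> Prop.
Hypothesis rP : residually_determined C P.
Hypothesis Rex : forall (H : groupType) (f : P -> H), C H -> lc_hom f ->
  exists2 g : Q -> H, lc_hom g & R f g.
Hypothesis Runique : forall (H : groupType) (f : P -> H) (g g' : Q -> H),
  C H -> lc_hom f -> lc_hom g -> lc_hom g' -> R f g -> R f g' -> g = g'.
Hypothesis Rnatural : forall (H K : groupType) (f : P -> H) (g : Q -> H)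
  (k : H -> K), C H -> C K -> is_hom k -> R f g ->
  R (fun x => k (f x)) (fun x => k (g x)).

(** A Yoneda argument: [R] is the graph of a natural map from homomorphisms on [P] to homomorphisms
    on [Q], and such a map is composition with one [u : Q -> P]. That [u] is multiplicative can be
    tested after homomorphisms to the class. *)
Lemma transfer_hom : exists u : Q -> P, continuous_hom u /\
  (forall (H : groupType) (f : P -> H) (g : Q -> H),
     C H -> lc_hom f -> lc_hom g -> R f g -> g = fun y => f (u y)).
Proof.
pose theta (H : groupType) (f : P -> H) : Q -> H :=
  if pselect (exists2 g : Q -> H, lc_hom g & R f g) is left e
  then projT1 (cid2 e) else fun=> 1.
have thetaP (H : groupType) (f : P -> H) : C H -> lc_hom f ->
    lc_hom (theta H f) /\ R f (theta H f).
  move=> CH lf; rewrite /theta; case: pselect => [e|[]]; last exact: Rex.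
  by case: cid2.
have [||u [[cu hu] _]] := rP (theta := theta).
- by move=> H f CH lf; have [[]] := thetaP H f CH lf.
- move=> H K f g CH CK lf hg; have [l1 R1] := thetaP H f CH lf.
  have [l2 R2] := thetaP K _ CK (lc_hom_post lf hg).
  apply: (Runique CK (lc_hom_post lf hg) l2 (lc_hom_post l1 hg) R2).
  exact: Rnatural.
exists u; split.
  split=> // x y; apply: (residually_separated rP) => H f CH lf.
  have [[_ hf] _] := thetaP H f CH lf.
  have e z : f (u z) = theta H f z by rewrite hu.
  by rewrite e hf lf.2 !e.
move=> H f g CH lf lg Rfg; have [l1 R1] := thetaP H f CH lf.
by rewrite -hu //; exact: (Runique CH lf lg l1).
Qed.

End Transfer.

Lemma correspondence_isomorphic (C : groupType -> Prop) (P Q : topGroupType)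
    (R : forall H : groupType, (P -> H) -> (Q -> H) -> Prop) :
  residually_determined C P -> residually_determined C Q ->
  (forall (H : groupType) (f : P -> H), C H -> lc_hom f ->
     exists2 g : Q -> H, lc_hom g & R H f g) ->
  (forall (H : groupType) (g : Q -> H), C H -> lc_hom g ->
     exists2 f : P -> H, lc_hom f & R H f g) ->
  (forall (H : groupType) (f : P -> H) (g g' : Q -> H),
     C H -> lc_hom f -> lc_hom g -> lc_hom g' -> R H f g -> R H f g' -> g = g') ->
  (forall (H : groupType) (g : Q -> H) (f f' : P -> H),
     C H -> lc_hom g -> lc_hom f -> lc_hom f' -> R H f g -> R H f' g -> f = f') ->
  (forall (H K : groupType) (f : P -> H) (g : Q -> H) (k : H -> K),
     C H -> C K -> is_hom k -> R H f g ->
     R K (fun x => k (f x)) (fun x => k (g x))) ->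
  topgroup_isomorphic P Q.
Proof.
move=> rP rQ exQ exP uQ uP nR.
have [u [cu hu]] := transfer_hom rP exQ uQ nR.
have [|w [cw hw]] := transfer_hom (R := fun H g f => R H f g) rQ exP uP.
  by move=> H K g f k CH CK hk; exact: nR.
exists w, u; split=> //.
- move=> x; apply: (residually_separated rP) => H f CH lf.
  have [g lg Rfg] := exQ H f CH lf.
  have -> : f (u (w x)) = g (w x) by rewrite (hu H f g).
  by rewrite [RHS](congr1 (@^~ x) (hw H g f CH lg lf Rfg)).
- move=> y; apply: (residually_separated rQ) => H g CH lg.
  have [f lf Rfg] := exP H g CH lg.
  have -> : g (w (u y)) = f (u y) by rewrite (hw H g f).
  by rewrite [RHS](congr1 (@^~ y) (hu H f g CH lf lg Rfg)).
Qed.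

(** * Quotients by normal subgroups and pro-C completions *)

Lemma to_quotient_hom (G : groupType) (N : normal_subgroup G) :
  is_hom (to_quotient N).
Proof. by move=> x y; rewrite -to_quotientM. Qed.

Section Kernel.
Variables (G H : groupType) (h : G -> H).
Hypothesis hh : is_hom h.

Lemma kernel_subproof :
  [/\ h 1 = 1, forall x y, h x = 1 -> h y = 1 -> h (x * y) = 1,
      forall x, h x = 1 -> h x^-1 = 1 & forall x y, h x = 1 -> h (x ^ y) = 1].
Proof.
split=> [|x y ex ey|x ex|x y ex]; first exact: hom1.
- by rewrite hh ex ey mulg1.
- by rewrite homV // ex invg1.
- by rewrite conjgE !hh ex mul1g homV // mulVg.
Qed.

Definition kernel : normal_subgroup G :=
  let: And4 k1 kM kV kJ := kernel_subproof in
  @NormalSubgroup G [set x | h x = 1] k1 kM kV kJ.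

Lemma kernelE x : ns_set kernel x <-> h x = 1.
Proof. by rewrite /kernel; case: kernel_subproof. Qed.

End Kernel.

Section QuotientMap.
Variables (G H : groupType) (h : G -> H) (N : normal_subgroup G).
Hypothesis hh : is_hom h.
Hypothesis hN : forall x, ns_set N x -> h x = 1.

Definition quotient_map (a : quotient_group N) : H := h (of_quotient a).

Lemma quotient_mapE x : quotient_map (to_quotient N x) = h x.
Proof.
have /hN : ns_set N ((of_quotient (to_quotient N x))^-1 * x).
  by apply/to_quotientP; rewrite of_quotientK.
by rewrite hh homV // => /(congr1 (mul (h (of_quotient (to_quotient N x))))); rewrite mulVKg mulg1 => ->.
Qed.

Lemma quotient_map_hom : is_hom quotient_map.
Proof.
move=> a b; rewrite -[a]of_quotientK -[b]of_quotientK -to_quotient_hom.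
by rewrite !quotient_mapE hh.
Qed.

End QuotientMap.

Lemma kernel_quotient_map_injective (G H : groupType) (h : G -> H) (hh : is_hom h) :
  injective (quotient_map h (N := kernel hh)).
Proof.
move=> a b; rewrite -[a]of_quotientK -[b]of_quotientK !quotient_mapE //.
- by move=> e; apply/to_quotientP/kernelE; rewrite hh homV // e mulVg.
- by move=> x /kernelE.
- by move=> x /kernelE.
Qed.

Lemma normal_subgroup_ext (G : groupType) (M N : normal_subgroup G) :
  ns_set M = ns_set N -> M = N.
Proof.
case: M N => [M M1 MM MV MJ] [N N1 NM NV NJ] /= e.
by case: _ / e in N1 NM NV NJ *; congr NormalSubgroup; exact: Prop_irrelevance.
Qed.

Section ClassClosure.
Variable C : groupType -> Prop.
Hypothesis hC : extension_closed_class C.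

Lemma class_prod (G H : groupType) : C G -> C H -> C (G * H)%type.
Proof.
apply: (class_extension hC (f := fun x => (x, 1)) (g := snd)).
- by move=> x y; congr pair; rewrite mulg1.
- by move=> x y [].
- by [].
- by move=> y _; exists (1, y).
- by apply/seteqP; split=> [_ [x _ <-] //|[x y] /= ->]; exists x.
Qed.

Lemma class_kernel (G H : groupType) (h : G -> H) (hh : is_hom h) :
  C H -> C (quotient_group (kernel hh)).
Proof.
apply: (class_subgroup hC (f := quotient_map h (N := kernel hh))).
- by apply: quotient_map_hom => // x /kernelE.
- exact: kernel_quotient_map_injective.
Qed.

Lemma class_unit : exists2 H : groupType, C H & forall x : H, x = 1.
Proof.
have [G CG] := class_nonempty hC; have h1 : is_hom (fun _ : G => 1 : G).
  by move=> x y; rewrite mulg1.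
exists (quotient_group (kernel h1)); first exact: class_kernel.
by move=> x; apply: kernel_quotient_map_injective.
Qed.

Lemma C_index_directed (G : groupType) : directed_poset (@C_index_le C G).
Proof.
split.
- have [H CH _] := class_unit.
  have h1 : is_hom (fun _ : G => 1 : H) by move=> x y; rewrite mulg1.
  exact: (inhabits (exist _ _ (class_kernel h1 CH))).
- by move=> M x.
- move=> [M CM] [N CN] MN NM; apply: eq_exist.
  by apply: normal_subgroup_ext; apply/seteqP.
- by move=> M N K MN NK x /NK /MN.
- move=> [M CM] [N CN].
  (* The intersection of [M] and [N] is taken as a kernel, so that its quotient embeds in a product
     of two groups of the class. *)
  have hh : is_hom (fun x => (to_quotient M x, to_quotient N x)).
    by move=> x y; rewrite !to_quotient_hom.
  exists (exist (fun N => C (quotient_group N)) (kernel hh)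
    (class_kernel hh (class_prod CM CN))).
  split=> x /kernelE [e1 e2].
    by rewrite /=; move/to_quotientP: (esym e1); rewrite invg1 mul1g.
  by rewrite /=; move/to_quotientP: (esym e2); rewrite invg1 mul1g.
Qed.

Lemma C_proj_to_quotient (G : groupType) (M N : C_index C G) :
  C_index_le M N ->
  forall x, @C_proj C G M N (to_quotient (sval N) x) = to_quotient (sval M) x.
Proof.
move=> MN x; apply/to_quotientP; apply: MN.
by apply/to_quotientP; rewrite of_quotientK.
Qed.

Lemma C_proj_hom (G : groupType) (M N : C_index C G) :
  C_index_le M N -> is_hom (@C_proj C G M N).
Proof.
move=> MN a b; rewrite -[a]of_quotientK -[b]of_quotientK -to_quotient_hom.
by rewrite !C_proj_to_quotient // to_quotient_hom.
Qed.

Section Completion.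
Variables (G : groupType) (L : topGroupType) (iota : G -> L).
Hypothesis cpl : is_proC_completion C iota.

Lemma completion_compact : compact [set: L].
Proof.
have [p [limL _ _]] := cpl.
by apply: (finite_limit_compact hC _ limL) => -[].
Qed.

Lemma completion_zero_dimensional : zero_dimensional L.
Proof. by have [p [limL _ _]] := cpl; exact: (finite_limit_zero_dimensional limL). Qed.

Lemma completion_determined : residually_determined C L.
Proof.
have [p [limL hp _]] := cpl.
apply: (finite_limit_determined hC (C_index_directed G) _ _ hp limL).
  by case.
by move=> M N; exact: C_proj_hom.
Qed.

Lemma completion_dense (H : groupType) (f g : L -> H) :
  lc_hom f -> lc_hom g -> (forall x, f (iota x) = g (iota x)) -> f = g.
Proof.
move=> [lf hf] [lg hg] e; have [p [limL hp pi]] := cpl.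
have cX (N : C_index C G) : compact [set: discrete_topology (C_quotient N)].
  by apply: (class_compact hC); case: N.
have zX (N : C_index C G) : zero_dimensional (discrete_topology (C_quotient N)).
  exact: discrete_zero_dimension.
(* Factoring the pair of maps puts [f] and [g] on one and the same quotient of [G], all of whose
   elements are images of elements of [G]. *)
have [N [k [_ hk]]] := limit_locally_constant (C_index_directed G) cX zX limL
  (1, 1) (locally_constant_pair lf lg).
apply/funext => x.
have ex : p N x = p N (iota (of_quotient (p N x))) by rewrite pi of_quotientK.
by have := hk x; rewrite ex -hk => -[-> ->].
Qed.

Lemma completion_extend (H : groupType) (h : G -> H) : C H -> is_hom h ->
  exists2 f : L -> H, lc_hom f & forall x, f (iota x) = h x.
Proof.
move=> CH hh; have [p [limL hp pi]] := cpl.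
pose N : C_index C G :=
  exist (fun N => C (quotient_group N)) (kernel hh) (class_kernel hh CH).
have hN x : ns_set (sval N) x -> h x = 1 by move/kernelE.
exists (fun x => quotient_map h (p N x)).
  apply: lc_hom_post; last exact: quotient_map_hom.
  exact: (finite_limit_lc_hom hp limL).
by move=> x; rewrite pi quotient_mapE.
Qed.

Lemma completion_hom : is_hom iota.
Proof.
have [p [limL hp pi]] := cpl.
move=> x y; apply: (limit_separated limL) => N.
by rewrite hp !pi to_quotient_hom.
Qed.

End Completion.
End ClassClosure.

(** With [p] and [q] paths from the base point to the two ends of [x], the element [p * x * q^-1] is
    a loop. Agreement on loops thus makes [(f p)^-1 * g p] a gauge between [f] and [g]. *)
Lemma hom_conj_eq (G H : groupType) (f g : G -> H) (x p q : G) :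
  is_hom f -> is_hom g -> f (p * x * q^-1) = g (p * x * q^-1) ->
  g x = ((f p)^-1 * g p)^-1 * f x * ((f q)^-1 * g q).
Proof.
move=> hf hg; rewrite !hf !hg (homV _ hf) (homV _ hg) => e.
have -> : g x = (g p)^-1 * (g p * g x * (g q)^-1) * g q.
  by rewrite !mulgA mulVg mul1g mulgVK.
by rewrite -e !invgM invgK !mulgA.
Qed.

(** * The abstract group F and its subgroup pi_1 *)

Section FundamentalGroup.
Variable GG : pgog.
Local Notation F := (Fgroup GG).

Lemma wclass_cat (u w : word GG) : wclass (u ++ w) = wclass u * wclass w :> F.
Proof. exact: (esym (FmulE u w)). Qed.

Lemma FvertexE (x : tot GG) (h : vtx (gpi x)) : Fvertex x = wclass [:: LV h].
Proof. by rewrite /Fvertex; case: pselect => // h'; rewrite (Prop_irrelevance h h'). Qed.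

Lemma FedgeE (e : base GG) (h : ~ vtx e) b : Fedge e b = wclass [:: LE h b].
Proof. by rewrite /Fedge; case: pselect => // h'; rewrite (Prop_irrelevance h h'). Qed.

Lemma Fvertex_hom (m : base GG) : is_hom (fun g : fib m => Fvertex (inc g)).
Proof.
move=> x y; have [hm|hm] := pselect (vtx m); last first.
  by rewrite !Fvertex_nonvertex ?gpi_inc // mulg1.
have h (z : fib m) : vtx (gpi (inc z)) by rewrite gpi_inc.
rewrite (FvertexE (h (x * y))) (FvertexE (h x)) (FvertexE (h y)) -wclass_cat.
by apply/wclassP; apply: we_sym; exact: we_mul.
Qed.

Lemma bd_vertex b (x : tot GG) : vtx (gpi (bd b x)).
Proof. by rewrite bd_pi; exact: gd_vtx. Qed.

Lemma bd_bd b b' (x : tot GG) : bd b (bd b' x) = bd b' x.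
Proof. by rewrite bd_id //; exact: bd_vertex. Qed.

Lemma gd_gd (X : pgraph) b b' (m : X) : gd b (gd b' m) = gd b' m.
Proof. by rewrite gd_id //; exact: gd_vtx. Qed.

Lemma Fvertex_edge (x : tot GG) :
  Fvertex (bd false x) =
  Fedge (gpi x) true * Fvertex (bd true x) * (Fedge (gpi x) true)^-1.
Proof.
have [h|h] := pselect (vtx (gpi x)).
  by rewrite Fedge_vertex // invg1 mul1g mulg1 !bd_id.
rewrite FedgeV (FvertexE (bd_vertex false x)) (FvertexE (bd_vertex true x)).
rewrite !(FedgeE h) -!wclass_cat.
by apply/wclassP; apply: we_sym; exact: we_rel.
Qed.

Lemma Fgroup_ind (P : F -> Prop) :
  P 1 -> (forall x y, P x -> P y -> P (x * y)) ->
  (forall x, vtx (gpi x) -> P (Fvertex x)) ->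
  (forall e b, P (Fedge e b)) -> forall x, P x.
Proof.
move=> P1 PM Pv Pe x; rewrite -[x]wreprK.
elim: (wrepr x) => [//|l u ih]; rewrite -cat1s wclass_cat.
apply: PM => //; case: l => [y hy|e he b].
  by rewrite -FvertexE; exact: Pv.
by rewrite -FedgeE.
Qed.

Lemma Fgroup_hom_ext (H : groupType) (f g : F -> H) :
  is_hom f -> is_hom g ->
  (forall x, vtx (gpi x) -> f (Fvertex x) = g (Fvertex x)) ->
  (forall e, f (Fedge e true) = g (Fedge e true)) -> f = g.
Proof.
move=> hf hg ev ee; apply/funext; apply: Fgroup_ind => //.
- by rewrite !hom1.
- by move=> x y ex ey; rewrite hf hg ex ey.
- by move=> e [|] //; rewrite -[false]/(~~ true) -FedgeV !homV // ee.
Qed.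

Section Universal.
Variables (H : groupType) (b : tot GG -> H) (t : base GG -> H).
Hypothesis hb : forall m, vtx m -> is_hom (fun g : fib m => b (inc g)).
Hypothesis hbt : forall x, b (bd false x) = t (gpi x) * b (bd true x) * (t (gpi x))^-1.

Let letter_val (l : letter GG) : H :=
  match l with
  | LV x _ => b x
  | LE e _ true => t e
  | LE e _ false => (t e)^-1
  end.

Let word_val (u : word GG) : H := \prod_(l <- u) letter_val l.

Let word_val_eq u w : word_eq u w -> word_val u = word_val w.
Proof.
rewrite /word_val; elim=> {u w} //.
- by move=> u w x _ -> _ ->.
- by move=> u u' w w' _ eu _ ew; rewrite !big_cat eu ew.
- move=> m h; rewrite big_seq1 big_nil /=.
  by rewrite gpi_inc in h *; exact: (hom1 (hb h)).
- move=> m x y hx hy hxy; rewrite big_cons !big_seq1 /=.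
  by rewrite gpi_inc in hx; rewrite (hb hx).
- by move=> e h [|]; rewrite big_cons big_seq1 /= ?mulgV ?mulVg big_nil.
- by move=> x he h0 h1; rewrite !big_cons !big_nil /= !mulg1 hbt !mulgA.
Qed.

(** At a vertex [Fedge] is 1 whatever [t] is, hence the restriction in the last clause. *)
Lemma Fgroup_universal : exists f : F -> H,
  [/\ is_hom f, forall x, vtx (gpi x) -> f (Fvertex x) = b x &
      forall e, ~ vtx e -> f (Fedge e true) = t e].
Proof.
have E u : word_val (wrepr (wclass u)) = word_val u.
  by apply: word_val_eq; exact: wreprP.
exists (fun x => word_val (wrepr x)); split.
- move=> x y; rewrite -[x]wreprK -[y]wreprK -wclass_cat !E.
  by rewrite /word_val big_cat.
- by move=> x hx; rewrite (FvertexE hx) E /word_val big_seq1.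
- by move=> e he; rewrite (FedgeE he) E /word_val big_seq1.
Qed.

End Universal.

(** The arrows from [v] to [w] of the fundamental groupoid, realised as elements of [F]; for [v = w]
    they are the elements of pi_1. *)
Definition path_in (v w : base GG) (x : F) : Prop :=
  exists c, [/\ gpi c.1 = v, steps v c.2 w & x = path_elt c].

Lemma pi1_predP v x : pi1_pred v x <-> path_in v v x.
Proof.
split=> [/asboolP[c [h1 h2] e]|[c [h1 h2 e]]]; first by exists c.
by apply/asboolP; exists c.
Qed.

Lemma path_in_vertex x : path_in (gpi x) (gpi x) (Fvertex x).
Proof.
by exists (x, [::]); split=> //; rewrite /path_elt /steps_elt big_nil mulg1.
Qed.

Lemma path_in_inc (m : base GG) (x : fib m) : path_in m m (Fvertex (inc x)).
Proof.
by move: (inc x) (gpi_inc x) => y e; have := path_in_vertex y; rewrite e.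
Qed.

Lemma path_in1 v : path_in v v 1.
Proof. by have := path_in_inc (1 : fib v); rewrite Fvertex_inc1. Qed.

Lemma path_in_edge e b : path_in (gd (~~ b) e) (gd b e) (Fedge e b).
Proof.
exists (inc (1 : fib (gd (~~ b) e)), [:: (e, b, inc (1 : fib (gd b e)))]).
split=> /=; rewrite ?gpi_inc //.
by rewrite /path_elt steps_elt_cons /steps_elt big_nil /= !Fvertex_inc1 mulg1 mul1g mulg1.
Qed.

Lemma path_inM u v w x y : vtx v -> path_in u v x -> path_in v w y ->
  path_in u w (x * y).
Proof.
move=> hv [c [c1 c2 ->]] [d [d1 d2 ->]].
(* The vertex [v] is inserted as a step of value 1, which keeps the last group element of [c] and
   the first of [d] apart. *)
exists (c.1, c.2 ++ (v, true, d.1) :: d.2); split=> //=.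
  by apply: steps_cat c2 _ => /=; rewrite !gd_id.
rewrite /path_elt /steps_elt big_cat big_cons /= Fedge_vertex // mul1g.
by rewrite !mulgA.
Qed.

Lemma path_inV u v x : vtx u -> path_in u v x -> path_in v u x^-1.
Proof.
move=> hu [[g s] [/= hg hs ->]].
by have [c [c1 c2 e]] := steps_inv hu hg hs; exists c; split.
Qed.

Lemma steps_vertex (u w : base GG) s : vtx u -> steps u s w -> vtx w.
Proof.
elim: s u => [|[[e b] g] s ih] u hu /=; first by move=> <-.
by case=> _ _; apply: ih; exact: gd_vtx.
Qed.

Lemma path_in_target (u w : base GG) x : vtx u -> path_in u w x -> vtx w.
Proof. by move=> hu [c [_ hs _]]; exact: steps_vertex hs. Qed.

Lemma path_ind (P : base GG -> base GG -> F -> Prop) :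
  (forall x, vtx (gpi x) -> P (gpi x) (gpi x) (Fvertex x)) ->
  (forall e b, P (gd (~~ b) e) (gd b e) (Fedge e b)) ->
  (forall u v w x y, vtx v -> P u v x -> P v w y -> P u w (x * y)) ->
  forall v w x, vtx v -> path_in v w x -> P v w x.
Proof.
move=> Pv Pe PM v w x hv [[g s] [/= hg hs ->]].
rewrite /path_elt /=; elim: s v g hv hg hs => [|[[e b] h] s ih] v g hv hg /=.
  by move=> <-; rewrite /steps_elt big_nil mulg1 -{1}hg -hg; apply: Pv; rewrite hg.
case=> h1 h2 h3; rewrite steps_elt_cons -mulgA.
apply: (PM _ v) => //; first by rewrite -{1}hg -hg; apply: Pv; rewrite hg.
apply: (PM _ (gd b e)); first exact: gd_vtx.
  by rewrite -h1; exact: Pe.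
by apply: ih => //; exact: gd_vtx.
Qed.

Lemma connected_path_in v w : abstractly_connected (base GG) ->
  vtx v -> vtx w -> exists x, path_in v w x.
Proof.
move=> cn hv hw; have := cn v w hv hw.
(* The closure is reflexive also at points that are not vertices, hence the disjunction in the
   induction statement. *)
suff S a b : Relation_Operators.clos_refl_sym_trans (base GG)
      (fun a b => exists e : base GG, gd false e = a /\ gd true e = b) a b ->
    (a = b \/ (vtx a /\ vtx b)) /\ exists x, path_in a b x.
  by move=> /S[].
elim=> {a b}.
- move=> a b [e [<- <-]]; split; first by right; split; exact: gd_vtx.
  by exists (Fedge e true); exact: (path_in_edge e true).
- by move=> a; split; [left|exists 1; exact: path_in1].
- move=> a b _ [[<-|[ha hb]] [x px]]; first by split; [left|exists x].
  by split; [right|exists x^-1; exact: path_inV].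
- move=> a b c _ [[<-|[ha hb]] [x px]] _ [[<-|[hb' hc]] [y py]].
  + by split; [left|exists x].
  + by split; [right|exists y].
  + by split; [right|exists x].
  + by split; [right|exists (x * y); exact: path_inM py].
Qed.

Section BasePoint.
Variable v : base GG.
Hypothesis hv : vtx v.
Hypothesis cn : abstractly_connected (base GG).

(** The normalisation [p v = 1] makes the retraction onto pi_1 the identity there, and makes the
    gauges built from [p] trivial at [v]. *)
Lemma base_paths : exists p : base GG -> F,
  p v = 1 /\ forall w, vtx w -> path_in v w (p w).
Proof.
pose p w := if pselect (w = v) is left _ then 1 else
  if pselect (vtx w) is left h then projT1 (cid (connected_path_in cn hv h)) else 1.
exists p; rewrite /p; split; first by case: pselect.
move=> w hw; case: pselect => [->|_]; first exact: path_in1.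
by case: pselect => // h; case: cid.
Qed.

(* [x |-> p x p'^-1], for chosen paths [p], [p'] from [v] to the ends of [x], is
   a retraction of [F] onto the fundamental group. *)
Lemma pi1_hom_extends (H : groupType) (f : pi1 v -> H) : is_hom f ->
  exists2 Phi : F -> H, is_hom Phi & forall x, Phi (pi1_val x) = f x.
Proof.
move=> hf; have [p [pv hp]] := base_paths.
(* Extending [f] by 1 outside pi_1 avoids carrying membership proofs; multiplicativity is claimed on
   loops only. *)
pose ev (x : F) : H := if pselect (pi1_pred v x) is left h then f (Pi1 h) else 1.
have evE (x : pi1 v) : ev (pi1_val x) = f x.
  rewrite /ev; case: pselect => [h|]; last by case: x.
  by congr f; apply: val_inj.
have evM x y : path_in v v x -> path_in v v y -> ev (x * y) = ev x * ev y.
  move=> /pi1_predP hx /pi1_predP hy.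
  have -> : ev (x * y) = f (Pi1 hx * Pi1 hy).
    by rewrite -evE; congr ev; exact: (esym (valM (Pi1 hx) (Pi1 hy))).
  by rewrite hf -!evE.
have ev1 : ev 1 = 1.
  apply: (mulgI (ev 1)); rewrite -evM ?mulg1 //; exact: path_in1.
have evV x : path_in v v x -> ev x^-1 = (ev x)^-1.
  move=> px; apply: (mulgI (ev x)); rewrite -evM ?mulgV //; exact: path_inV.
have loop u w x : vtx u -> vtx w -> path_in u w x -> path_in v v (p u * x * (p w)^-1).
  move=> hu hw px; apply: (path_inM hw); last by apply: path_inV => //; exact: hp.
  by apply: (path_inM hu) => //; exact: hp.
have split_loop u w z x y : p u * (x * y) * (p z)^-1 =
    (p u * x * (p w)^-1) * (p w * y * (p z)^-1).
  by rewrite !mulgA mulgVK.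
have [||Phi [hPhi Pv Pe]] := @Fgroup_universal H
  (fun x => ev (p (gpi x) * Fvertex x * (p (gpi x))^-1))
  (fun e => ev (p (gd false e) * Fedge e true * (p (gd true e))^-1)).
- move=> m hm x y; rewrite !gpi_inc Fvertex_hom (split_loop m m) evM //;
    apply: loop => //; exact: path_in_inc.
- move=> x; rewrite !bd_pi; set e := gpi x.
  have h0 := gd_vtx false e; have h1 := gd_vtx true e.
  have l0 : path_in v v (p (gd false e) * Fedge e true * (p (gd true e))^-1).
    by apply: loop => //; exact: (path_in_edge e true).
  have l1 : path_in v v (p (gd true e) * Fvertex (bd true x) * (p (gd true e))^-1).
    by apply: loop => //; rewrite -bd_pi; exact: path_in_vertex.
  rewrite -evV // -evM // -evM; last 2 first.
  + exact: (path_inM hv).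
  + exact: path_inV.
  by congr ev; rewrite Fvertex_edge !invgM !invgK !mulgA !mulgVK.
exists Phi => // x.
(* The generalisation from loops at [v] to arbitrary paths is what path induction can prove; for a
   loop at [v] the two chosen paths are 1. *)
suff E u w y : vtx u -> path_in u w y -> Phi y = ev (p u * y * (p w)^-1).
  rewrite (E v v) // ?pv ?mul1g ?invg1 ?mulg1 ?evE //.
  by apply/pi1_predP; case: x.
move=> hu pu.
have Ppath := path_ind (P := fun u w y => vtx u -> path_in u w y /\
  Phi y = ev (p u * y * (p w)^-1)).
have [] // := Ppath _ _ _ u w y hu pu hu.
- by move=> z hz _; split; [exact: path_in_vertex|exact: Pv].
- move=> e b _; split; first exact: path_in_edge.
  have [he|he] := pselect (vtx e).
    by rewrite Fedge_vertex // !gd_id // mulg1 mulgV ev1 hom1.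
  case: b; first exact: Pe.
  rewrite -[false]/(~~ true) -FedgeV homV // Pe // -evV.
    by rewrite !invgM invgK mulgA.
  by apply: loop; [exact: gd_vtx|exact: gd_vtx|exact: (path_in_edge e true)].
- move=> a b c z t hb Pz Pt ha; have [pz ez] := Pz ha; have [pt et] := Pt hb.
  split; first exact: (path_inM hb).
  rewrite hPhi ez et (split_loop _ b) -evM //; apply: loop => //.
  exact: (path_in_target hb pt).
Qed.

Lemma homs_agree_gauge (H : groupType) (f g : F -> H) :
  is_hom f -> is_hom g -> (forall x, pi1_pred v x -> f x = g x) ->
  exists u : base GG -> H, [/\ u v = 1,
    forall x, vtx (gpi x) ->
      g (Fvertex x) = (u (gpi x))^-1 * f (Fvertex x) * u (gpi x) &
    forall e, g (Fedge e true) =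
      (u (gd false e))^-1 * f (Fedge e true) * u (gd true e)].
Proof.
move=> hf hg e; have [p [pv hp]] := base_paths.
exists (fun w => (f (p w))^-1 * g (p w)); split.
- by rewrite pv (hom1 hf) (hom1 hg) invg1 mulg1.
- move=> x hx; apply: hom_conj_eq => //; apply: e; apply/pi1_predP.
  apply: (path_inM hx); last by apply: path_inV => //; exact: hp.
  apply: (path_inM hx); [exact: hp|exact: path_in_vertex].
- move=> d; have h0 := gd_vtx false d; have h1 := gd_vtx true d.
  apply: hom_conj_eq => //; apply: e; apply/pi1_predP.
  apply: (path_inM h1); last by apply: path_inV => //; exact: hp.
  by apply: (path_inM h0); [exact: hp|exact: (path_in_edge d true)].
Qed.

End BasePoint.
End FundamentalGroup.

Lemma graph_morphism_vertex (X Y : pgraph) (f : X -> Y) (m : X) :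
  graph_morphism f -> vtx m -> vtx (f m).
Proof.
by move=> [_ hf] hm; rewrite -(gd_id false hm) hf; exact: gd_vtx.
Qed.

Section Morphism.
Variables (GG HH : pgog) (al : tot GG -> tot HH) (al' : base GG -> base HH).
Hypothesis mor : gog_morphism al al'.
Variables (H : groupType) (Phi : Fgroup HH -> H) (u : base GG -> H).
Hypothesis hPhi : is_hom Phi.

(** Pull-back along the morphism, changed by the gauge [u]. Along a path the inner gauge factors
    cancel, so a loop at a vertex where [u] is 1 keeps its value. *)
Lemma Fgroup_pullback : exists Psi : Fgroup GG -> H,
  [/\ is_hom Psi,
    forall x, vtx (gpi x) ->
      Psi (Fvertex x) = u (gpi x) * Phi (Fvertex (al x)) * (u (gpi x))^-1,
    forall e, Psi (Fedge e true) =
      u (gd false e) * Phi (Fedge (al' e) true) * (u (gd true e))^-1 &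
    forall v w c, vtx v -> gpi c.1 = v -> steps v c.2 w ->
      Psi (path_elt c) = u v * Phi (path_elt (Defs.map_path al al' c)) * (u w)^-1].
Proof.
case: mor => _ mor' gal fal bal.
have [||Psi [hPsi Pv Pe]] := @Fgroup_universal GG H
  (fun x => u (gpi x) * Phi (Fvertex (al x)) * (u (gpi x))^-1)
  (fun e => u (gd false e) * Phi (Fedge (al' e) true) * (u (gd true e))^-1).
- move=> m hm x y; rewrite !gpi_inc.
  have [f [hf ef]] := fal m.
  by rewrite !ef hf Fvertex_hom hPhi !mulgA !mulgVK.
- move=> x; rewrite !bd_pi !bal Fvertex_edge gal !hPhi (homV _ hPhi).
  by rewrite !invgM !invgK !mulgA !mulgVK.
have Pet e : Psi (Fedge e true) =
    u (gd false e) * Phi (Fedge (al' e) true) * (u (gd true e))^-1.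
  have [he|he] := pselect (vtx e); last exact: Pe.
  rewrite !Fedge_vertex //; last exact: (graph_morphism_vertex mor').
  by rewrite !gd_id // (hom1 hPsi) (hom1 hPhi) mulg1 mulgV.
have Peb e b : Psi (Fedge e b) =
    u (gd (~~ b) e) * Phi (Fedge (al' e) b) * (u (gd b e))^-1.
  case: b => //; rewrite -[false]/(~~ true) -!FedgeV (homV _ hPsi) (homV _ hPhi).
  by rewrite Pet !invgM invgK mulgA.
exists Psi; split=> // v w [g s] /=.
rewrite /path_elt /=; elim: s v g => [|[[e b] h] s ih] v g hv hg /=.
  move=> <-; rewrite /steps_elt !big_nil !mulg1 Pv; first by rewrite hg.
  by rewrite hg.
case=> h1 h2 h3; rewrite !steps_elt_cons /= -!mulgA hPsi Pv ?hg //.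
rewrite hPsi (ih _ _ (gd_vtx b e) h2 h3).
by rewrite Peb h1 !hPhi !mulgA !mulgVK.
Qed.

End Morphism.

(** [Fvertex] is 1 on the fibres over edges, whereas a specialisation must satisfy
    [b x = b (bd false x)] there; composing with [bd false] gives these elements the forced
    value. *)
Lemma Fgroup_specialisation (GG : pgog) (H : groupType) (Phi : Fgroup GG -> H)
    (b := fun x => Phi (Fvertex (bd false x))) :
  is_hom Phi ->
  fibre_hom b /\ forall x, b x = b (bd false x) /\
    b x = Phi (Fedge (gpi x) true) * b (bd true x) * (Phi (Fedge (gpi x) true))^-1.
Proof.
move=> hPhi; split.
  move=> m; have [f [hf _ ef]] := bd_fib false m.
  by move=> x y; rewrite /b !ef hf Fvertex_hom hPhi.
by move=> x; rewrite /b !bd_bd; split=> //; rewrite Fvertex_edge !hPhi (homV _ hPhi).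
Qed.

(** * Connected profinite graphs and coverings *)

Lemma profinite_bool : profinite bool.
Proof.
split; [exact: bool_compact|exact: discrete_hausdorff|].
exact/zero_dimension_totally_disconnected/discrete_zero_dimension.
Qed.

Lemma connected_graph_constant (X : pgraph) (S : Type) (c : X -> S) :
  connected_graph X -> locally_constant c ->
  (forall b x, c (gd b x) = c x) -> forall x y, c x = c y.
Proof.
move=> cX lc ic x y; apply: contrapT => hxy.
(* The graph with two vertices and no edges; a non-constant [c] would map [X] onto it. *)
pose D := @PGraph bool setT (fun _ => id) profinite_bool
  (ex_intro _ true I) closedT (fun _ _ => @cvg_id _ _) (fun _ _ => I)
  (fun _ _ _ => erefl).
have ld : locally_constant (fun z => `[< c z = c y >]).
  exact: (locally_constant_post (fun s => `[< s = c y >]) lc).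
have mf : @graph_morphism X D (fun z => `[< c z = c y >]).
  split; last by move=> b z; rewrite ic.
  by move=> z A /nbhs_singleton Az; apply: filterS (ld z) => w /= ->.
have fD : finite_set [set: D] by exact: finite_finset.
have sf : set_surj [set: X] [set: D] (fun z => `[< c z = c y >]).
  move=> b _; exists (if b then y else x) => //=; case: b; first exact/asboolP.
  exact/asboolPn.
have S0 (a b : D) : Relation_Operators.clos_refl_sym_trans D
    (fun a b => exists e : D, gd false e = a /\ gd true e = b) a b -> a = b.
  by elim=> // [{}a {}b [e [<- <-]]|{}a {}b d _ -> _ ->].
by have := S0 _ _ (cX D _ fD mf sf true false I I).
Qed.

Lemma connected_graphP (X : pgraph) :
  (forall A : set X, clopen A -> (forall b x, A (gd b x) <-> A x) ->
     forall x y, A x -> A y) -> connected_graph X.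
Proof.
move=> h D f fD mf sf v w hv hw.
pose R := Relation_Operators.clos_refl_sym_trans D
    (fun a b => exists e : D, gd false e = a /\ gd true e = b).
have [x _ ex] := sf v I; have [y _ ey] := sf w I.
(* The preimage of the component of [v]; an edge is tested through its initial vertex, since [R]
   links an edge that is not a vertex only to itself. *)
pose A := [set z | R v (gd false (f z))].
suff : A y by rewrite /A /= ey gd_id.
apply: (h A _ _ x).
- have [_ hD _] := pg_profinite D.
  have lA : locally_constant (fun z => `[< R v (gd false (f z)) >]).
    apply: (locally_constant_pre mf.1 (g := fun d => `[< R v (gd false d) >])).
    exact: finite_hausdorff_locally_constant.
  have -> : A = [set z | `[< R v (gd false (f z)) >] = true].
    by apply/seteqP; split=> z /asboolP.
  split; first exact: (@locally_constant_open _ _ _ (fun b => b = true) lA).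
  exact: (@locally_constant_closed _ _ _ (fun b => b = true) lA).
- move=> b z; rewrite /A /= mf.2 gd_gd; case: b => //.
  have E : R (gd false (f z)) (gd true (f z)).
    by apply: Relation_Operators.rst_step; exists (f z).
  split=> h1; apply: Relation_Operators.rst_trans h1 _ => //.
  exact: Relation_Operators.rst_sym.
- by rewrite /A /= ex gd_id //; exact: Relation_Operators.rst_refl.
Qed.

Lemma totally_disconnected_prod (T U : topologicalType) :
  totally_disconnected [set: T] -> totally_disconnected [set: U] ->
  totally_disconnected [set: T * U].
Proof.
move=> dT dU [x1 x2] _; apply/seteqP; split=> [[y1 y2] [B [Bx _ cB] By]|_ ->]; last first.
  exact: connected_component_refl.
have -> : y1 = x1.
  have : connected_component [set: T] x1 y1.
    exists (fst @` B); last by exists (y1, y2).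
    split=> //; first by exists (x1, x2).
    apply: connected_continuous_connected => //.
    by apply: continuous_subspaceT => z; exact: cvg_fst.
  by rewrite dT.
have -> // : y2 = x2.
have : connected_component [set: U] x2 y2.
  exists (snd @` B); last by exists (y1, y2).
  split=> //; first by exists (x1, x2).
  apply: connected_continuous_connected => //.
  by apply: continuous_subspaceT => z; exact: cvg_snd.
by rewrite dU.
Qed.

Lemma profinite_prod (T U : topologicalType) :
  profinite T -> profinite U -> profinite (T * U)%type.
Proof.
move=> [cT hT dT] [cU hU dU]; split.
- exact: compact_setTX.
- exact: hausdorff_prod.
- exact: totally_disconnected_prod.
Qed.

Lemma profinite_discrete (S : choiceType) :
  finite_set [set: S] -> profinite (discrete_topology S).
Proof.
move=> fS; split; [exact: finite_compact|exact: discrete_hausdorff|].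
exact/zero_dimension_totally_disconnected/discrete_zero_dimension.
Qed.

Lemma finite_minimal (S : choiceType) (P : set (set S)) (A : set S) :
  finite_set [set: S] -> P A ->
  exists2 B, P B & forall B', P B' -> B' `<=` B -> B' = B.
Proof.
move=> fS PA; have fin (B : set S) : finite_set B.
  exact: (sub_finite_set (@subsetT _ _) fS).
pose Q n := `[< exists2 B, P B & (#|` fset_set B|)%fset = n >].
have exQ : exists n, Q n by exists (#|` fset_set A|)%fset; apply/asboolP; exists A.
case: (ex_minnP exQ) => n /asboolP[B PB Bn] mn.
exists B => // B' PB' BB'; apply: fset_set_inj => //.
apply/eqP; apply: contrapT => /negP ne.
have lt : (fset_set B' `<` fset_set B)%fset.
  by rewrite fproperEneq ne /= -fset_set_sub.
have := fproper_ltn_card lt; rewrite Bn ltnNge mn //.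
by apply/asboolP; exists B'.
Qed.

(** * The covering twisted by a cocycle *)

Section TwistedCover.
Variables (C : groupType -> Prop) (X : pgraph) (A : groupType) (t : X -> A).
Hypothesis hC : extension_closed_class C.
Hypothesis CA : C A.
Hypothesis lt : locally_constant t.
Hypothesis t1 : forall x, vtx x -> t x = 1.
Local Notation dA := (discrete_topology A).

(** An edge at height [a] over [x] runs from height [a] to height [a * t x]. Right multiplication
    commutes with the left action of [A], and [t = 1] on vertices makes both maps the identity
    there. *)
Definition twisted_gd (b : bool) (p : X * dA) : X * dA :=
  (gd b p.1, if b then p.2 * t p.1 else p.2).

Fact twisted_gd_continuous b : continuous (twisted_gd b).
Proof.
apply: continuous_pair.
  by apply: continuous_then (@gd_continuous X b); exact: continuous_fst.
case: b; last exact: continuous_snd.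
apply/(@locally_constantP _ A).
have l1 : locally_constant (fun p : X * dA => p.2 : A).
  by apply/(@locally_constantP _ A); exact: continuous_snd.
have l2 : locally_constant (fun p : X * dA => t p.1).
  by apply: locally_constant_pre lt; exact: continuous_fst.
exact: (locally_constant_post (fun s => s.1 * s.2) (locally_constant_pair l1 l2)).
Qed.

Fact twisted_vtx_nonempty : [set p : X * dA | vtx p.1] !=set0.
Proof. by have [x hx] := vtx_nonempty X; exists (x, 1). Qed.

Fact twisted_vtx_closed : closed [set p : X * dA | vtx p.1].
Proof.
apply: (iffLR (continuous_closedP _)) (@vtx_closed X); exact: continuous_fst.
Qed.

Fact twisted_gd_vtx b (p : X * dA) : vtx (twisted_gd b p).1.
Proof. exact: gd_vtx. Qed.

Fact twisted_gd_id b (p : X * dA) : vtx p.1 -> twisted_gd b p = p.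
Proof.
case: p => x a /= hx; rewrite /twisted_gd /= gd_id // t1 // mulg1.
by case: b.
Qed.

Definition twisted_graph : pgraph :=
  PGraph (profinite_prod (pg_profinite X) (profinite_discrete (class_finite hC CA)))
    twisted_vtx_nonempty twisted_vtx_closed twisted_gd_continuous
    twisted_gd_vtx twisted_gd_id.

Definition twisted_act (a : dA) (p : twisted_graph) : twisted_graph :=
  ((p : X * dA).1, a * (p : X * dA).2).

Fact twisted_act_continuous :
  continuous (fun p : dA * twisted_graph => twisted_act p.1 p.2).
Proof.
have c2 : continuous (fun p : dA * (X * dA) => p.2.2).
  by apply: (continuous_then (@continuous_snd _ _)); exact: continuous_snd.
apply: continuous_pair.
  by apply: (continuous_then (@continuous_snd _ _)); exact: continuous_fst.
apply: (@continuous_then _ _ _ (fun p : dA * (X * dA) => (p.1, p.2.2))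
  (fun p : dA * dA => p.1 * p.2)); last exact: mulg_continuous.
by apply: continuous_pair => //; exact: continuous_fst.
Qed.

Fact twisted_act_1 p : twisted_act 1 p = p.
Proof. by case: p => x a; rewrite /twisted_act /= mul1g. Qed.

Fact twisted_act_M a b p : twisted_act (a * b) p = twisted_act a (twisted_act b p).
Proof. by rewrite /twisted_act /= mulgA. Qed.

Fact twisted_act_gd a i p : gd i (twisted_act a p) = twisted_act a (gd i p).
Proof.
by case: p => x b; rewrite /twisted_act /= /twisted_gd /=; case: i; rewrite ?mulgA.
Qed.

Fact twisted_act_free a p : twisted_act a p = p -> a = 1.
Proof. by case: p => x b [] e; apply: (mulIg b); rewrite mul1g. Qed.

Fact twisted_zeta_morphism : graph_morphism (fun p : twisted_graph => (p : X * dA).1).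
Proof. by split=> //; exact: continuous_fst. Qed.

Fact twisted_zeta_surj : set_surj [set: twisted_graph] [set: X]
  (fun p : twisted_graph => (p : X * dA).1).
Proof. by move=> x _; exists (x, 1). Qed.

Fact twisted_zeta_orbit (p q : twisted_graph) :
  (p : X * dA).1 = (q : X * dA).1 <-> exists a, q = twisted_act a p.
Proof.
case: p q => [x a] [y b]; split=> /= [<-|[c [-> _]] //].
by exists (b * a^-1); rewrite /twisted_act /= mulgVK.
Qed.

Definition twisted_cover : galois_cover C X :=
  GaloisCover (proC_discrete CA) twisted_act_continuous twisted_act_1 twisted_act_M
    twisted_act_gd twisted_act_free twisted_zeta_morphism twisted_zeta_surj
    twisted_zeta_orbit.

End TwistedCover.

Section Subgroup.
Variables (H : groupType) (S : pred H).

Record subgroup_of (hS : group_closed S) :=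
  SubgroupOf { subgroup_val : H; subgroup_valP : S subgroup_val }.

Variable hS : group_closed S.
HB.instance Definition _ := [isSub for @subgroup_val hS].
HB.instance Definition _ := [Choice of subgroup_of hS by <:].
HB.instance Definition _ :=
  SubChoice_isSubGroup.Build H S (subgroup_of hS) hS.

Lemma subgroup_val_hom : is_hom (@subgroup_val hS).
Proof. exact: (@valM H S (subgroup_of hS)). Qed.

Lemma subgroup_val_inj : injective (@subgroup_val hS).
Proof. exact: val_inj. Qed.

End Subgroup.

(** * Cocycles on a connected graph without non-trivial connected Galois coverings *)

Section CoverSection.
Variables (C : groupType -> Prop) (X : pgraph) (H : groupType) (t : X -> H).
Hypothesis hC : extension_closed_class C.
Hypothesis CH : C H.
Hypothesis cX : connected_graph X.
Hypothesis lt : locally_constant t.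
Hypothesis t1 : forall x, vtx x -> t x = 1.

(* A clopen subgraph of the cover [X * H] twisted by [t] that is a union of
   connected components, given by its fibres. *)
Definition invariant_family (D : X -> set H) :=
  [/\ locally_constant D, forall x, D (gd false x) = D x &
      forall x, D (gd true x) = [set h * t x | h in D x]].

Lemma mul_imageP (A : set H) a h : [set k * a | k in A] h <-> A (h * a^-1).
Proof.
split=> [[k Ak <-]|Ah]; first by rewrite mulgK.
by exists (h * a^-1); rewrite ?mulgVK.
Qed.

(** Along an edge both fibres undergo the same right translation, so the truth of [Q] is a locally
    constant function unchanged along edges; connectedness spreads it from one point to all. *)
Lemma invariant_family_pred (D E : X -> set H) (Q : set H -> set H -> Prop) :
  invariant_family D -> invariant_family E ->
  (forall A B a, Q [set h * a | h in A] [set h * a | h in B] <-> Q A B) ->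
  forall x y, Q (D x) (E x) -> Q (D y) (E y).
Proof.
move=> [lD D0 D1] [lE E0 E1] hQ x y.
have e : `[< Q (D x) (E x) >] = `[< Q (D y) (E y) >].
  apply: (connected_graph_constant (c := fun z => `[< Q (D z) (E z) >]) cX).
    exact: (locally_constant_post (fun A => `[< Q A.1 A.2 >])
      (locally_constant_pair lD lE)).
  move=> [] z; last by rewrite D0 E0.
  by rewrite D1 E1; apply/asboolP/asboolP => /hQ.
by move=> /asboolP; rewrite e => /asboolP.
Qed.

Lemma invariant_translate (D : X -> set H) a :
  invariant_family D -> invariant_family (fun x => [set h | D x (a^-1 * h)]).
Proof.
move=> [lD D0 D1]; split.
- exact: (locally_constant_post (fun A : set H => [set h | A (a^-1 * h)]) lD).
- by move=> x; rewrite D0.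
- move=> x; apply/seteqP; split=> h; rewrite /= D1.
    by move/mul_imageP => Dh; apply/mul_imageP; rewrite /= mulgA.
  by move/mul_imageP => /= Dh; apply/mul_imageP; rewrite -mulgA.
Qed.

Lemma invariant_inter (D E : X -> set H) :
  invariant_family D -> invariant_family E ->
  invariant_family (fun x => D x `&` E x).
Proof.
move=> [lD D0 D1] [lE E0 E1]; split.
- exact: (locally_constant_post (fun A => A.1 `&` A.2) (locally_constant_pair lD lE)).
- by move=> x; rewrite D0 E0.
- move=> x; rewrite D1 E1; apply/seteqP; split=> h.
    by move=> [/mul_imageP Dh /mul_imageP Eh]; apply/mul_imageP.
  by move=> /mul_imageP [Dh Eh]; split; apply/mul_imageP.
Qed.

Lemma invariant_setT : invariant_family (fun _ => setT).
Proof.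
split=> //; first exact: locally_constant_cst.
by move=> x; apply/seteqP; split=> h _ //; apply/mul_imageP.
Qed.

(** Minimality is needed over [x0] only, where finiteness of [H] provides it; non-emptiness and
    equality of fibres then spread over [X] by connectedness. *)
Lemma minimal_invariant_family (x0 : X) : exists D, [/\ invariant_family D,
  forall x, D x !=set0 &
  forall E, invariant_family E -> E x0 !=set0 -> E x0 `<=` D x0 ->
    forall x, E x = D x].
Proof.
pose P A := exists D, [/\ invariant_family D, D x0 = A & A !=set0].
have [||B [D [iD DB nB]] mB] := @finite_minimal H P setT.
- exact: (class_finite hC CH).
- by exists (fun=> setT); split=> //; [exact: invariant_setT|exists 1].
exists D; split=> //.
- move=> x; apply: (@invariant_family_pred D D (fun A _ => A !=set0)) (x0) _ _ => //.
    move=> A _ a; split=> [[_ [h Ah _]]|[h Ah]]; first by exists h.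
    by exists (h * a); apply/mul_imageP; rewrite mulgK.
  by rewrite DB.
- move=> E iE nE ED x.
  apply: (@invariant_family_pred E D (fun A B => A = B)) (x0) _ _ => //.
    move=> A A' a; split=> [/seteqP[h1 h2]|-> //].
    apply/seteqP; split=> h Ah.
      have /h1/mul_imageP : [set k * a | k in A] (h * a) by apply/mul_imageP; rewrite mulgK.
      by rewrite mulgK.
    have /h2/mul_imageP : [set k * a | k in A'] (h * a) by apply/mul_imageP; rewrite mulgK.
    by rewrite mulgK.
  by rewrite DB; apply: mB; [exists E|rewrite -DB].
Qed.

Hypothesis universalX : forall D : galois_cover C X,
  connected_graph D -> injective (zeta (g := D)).

(* The stabiliser [A] of a minimal clopen subgraph [D] of the cover acts simply
   transitively on the fibres of [D]; a choice of [u x] in [D x] depending only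
   on [D x] reduces [t] to a cocycle in [A] whose twisted cover is connected,
   so [A] is trivial. *)
Lemma cocycle_trivial : exists u : X -> H, [/\ locally_constant u,
  forall x, u (gd false x) = u x & forall x, u (gd true x) = u x * t x].
Proof.
have [x0 _] := vtx_nonempty X.
have [D [iD nD mD]] := minimal_invariant_family x0.
have [lD D0 D1] := iD.
pose S a := `[< forall x h, D x (a^-1 * h) <-> D x h >].
have hS : group_closed S.
  split; first by apply/asboolP => x h; rewrite invg1 mul1g.
  move=> a b /asboolP ha /asboolP hb; apply/asboolP => x h.
  have := hb x (b * (a^-1 * h)); rewrite mulKg invgM invgK -mulgA => e.
  exact: iff_trans (iff_sym e) (ha x h).
(* The translate of [D] by [h * k^-1] meets [D] over [x], so by minimality it contains [D];
   exchanging [h] and [k] gives the reverse inclusion. *)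
have SD x h k : D x h -> D x k -> S (h * k^-1).
  suff main h' k' : D x h' -> D x k' -> forall y l, D y l -> D y (k' * h'^-1 * l).
    move=> Dh Dk; apply/asboolP => y l; rewrite invgM invgK.
    split=> [Dl|]; last exact: main.
    by have := main _ _ Dk Dh y _ Dl; rewrite !mulgA mulgVK mulgV mul1g.
  move=> Dh Dk.
  have iE := invariant_inter (invariant_translate (h' * k'^-1) iD) iD.
  set E := (E in invariant_family E) in iE.
  have ED y : E y = D y.
    apply: mD => //; last by move=> ? [].
    apply: (@invariant_family_pred E E (fun A _ => A !=set0)) (x) _ _ => //.
      move=> A _ a; split=> [[_ [l Al _]]|[l Al]]; first by exists l.
      by exists (l * a); apply/mul_imageP; rewrite mulgK.
    by exists h'; split=> //=; rewrite invgM invgK mulgVK.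
  move=> y l Dl; have : E y l by rewrite ED.
  by move=> [] /=; rewrite invgM invgK.
pose u x := xget 1 (D x).
have Du x : D x (u x) by have [h Dh] := nD x; exact: (xgetPex 1 (ex_intro _ h Dh)).
have lu : locally_constant u := locally_constant_post (xget 1) lD.
have u0 x : u (gd false x) = u x by rewrite /u D0.
have St x : S (u x * t x * (u (gd true x))^-1).
  by apply: SD (Du _); rewrite D1; exists (u x).
pose A := subgroup_of hS.
pose t' x : A := SubgroupOf hS (St x).
have CA : C A := class_subgroup hC (@subgroup_val_hom _ _ hS) (@subgroup_val_inj _ _ hS) CH.
have lt' : locally_constant t'.
  have lv : locally_constant (fun x => u x * t x * (u (gd true x))^-1).
    have l3 := locally_constant_pre (@gd_continuous X true) lu.
    exact: (locally_constant_post (fun s => s.1.1 * s.1.2 * s.2^-1)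
      (locally_constant_pair (locally_constant_pair lu lt) l3)).
  by move=> x; apply: filterS (lv x) => y /= e; exact: subgroup_val_inj.
have t'1 x : vtx x -> t' x = 1.
  move=> hx; apply: subgroup_val_inj.
  by rewrite /= t1 // gd_id // mulg1 mulgV -(hom1 (@subgroup_val_hom _ _ hS)).
pose W := twisted_cover hC CA lt' t'1.
have cW : connected_graph W.
  apply: connected_graphP => B cB iB [y0 a0] [y1 a1] By0.
  (* The map [(x, a) |-> (x, a * u x)] identifies [W] with the subgraph [D]. The image [E] of [B] is
     a non-empty invariant family inside [D], hence equal to it, so [B] is all of [W]. *)
  pose E x := [set h | exists2 a : A, B (x, a) & h = subgroup_val a * u x].
  have vM : {morph @subgroup_val _ _ hS : a b / a * b} := @subgroup_val_hom _ _ hS.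
  have iE : invariant_family E.
    split.
    - suff lB : locally_constant (fun x => [set a : A | B (x, a)]).
        move=> x; apply: filterS2 (lB x) (lu x) => y eB eu.
        by rewrite /E eu; apply/seteqP; split=> h [a Ba ->]; exists a => //;
          have := congr1 (@^~ a) eB; rewrite /= => e; move: Ba; rewrite e.
      move=> x; have fA := class_finite hC CA.
      have /(@filter_bigI _ A (fset_set setT) (fun a => [set y | B (y, a) = B (x, a)]) _ _) :
          forall a : A, a \in fset_set setT -> nbhs x [set y | B (y, a) = B (x, a)].
        move=> a _.
        have la : locally_constant (fun y => `[< B (y, a) >]).
          apply: (locally_constant_pre (f := fun y : X => (y, a : discrete_topology A)))
            (locally_constant_bool cB).
          by apply: continuous_pair => // z; [exact: cvg_id|exact: cvg_cst].
        apply: filterS (la x) => y /= e; apply/propext.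
        by split=> h; apply/asboolP; [rewrite -e|rewrite e]; apply/asboolP.
      rewrite fset_setK // => h; apply: filterS h => y hy.
      by apply/seteqP; split=> a /=; rewrite (hy a I).
    - move=> x; rewrite /E u0; apply/seteqP; split=> h [a Ba ->]; exists a => //.
        exact: (iffLR (iB false (x, a))).
      exact: (iffRL (iB false (x, a))).
    - move=> x; apply/seteqP; split=> h.
        move=> [a Ba ->]; apply/mul_imageP; exists (a * (t' x)^-1).
          apply: (iffLR (iB true (x, a * (t' x)^-1))).
          by rewrite /= /twisted_gd /= mulgVK.
        by rewrite vM (homV _ vM) /= !invgM !invgK !mulgA mulgVK.
      move/mul_imageP => [a Ba e]; exists (a * t' x).
        exact: (iffRL (iB true (x, a))).
      by rewrite vM /= !mulgA -e !mulgVK.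
  have uE (a : A) y : D y (subgroup_val a * u y).
    have /asboolP h := subgroup_valP a.
    by apply/(iffLR (h y (subgroup_val a * u y))); rewrite mulKg; exact: Du.
  have nE : E x0 !=set0.
    apply: (@invariant_family_pred E E (fun A _ => A !=set0)) (y0) _ _ => //.
      move=> F _ a; split=> [[_ [l Al _]]|[l Al]]; first by exists l.
      by exists (l * a); apply/mul_imageP; rewrite mulgK.
    by exists (subgroup_val a0 * u y0); exists a0.
  have ED x : E x = D x by apply: mD => // h [a _ ->].
  have [a Ba e] : E y1 (subgroup_val a1 * u y1) by rewrite ED.
  suff -> : a1 = a by [].
  by apply: subgroup_val_inj; apply: (mulIg (u y1)).
(* All of [A] lies over [x0] in the connected covering [W], whose projection is injective. *)
have triv a : a = 1 :> A.
  have := @universalX W cW (x0, a) (x0, 1) erefl.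
  by case.
exists u; split=> // x.
have /(congr1 (@subgroup_val _ _ hS)) := triv (t' x).
rewrite (hom1 (@subgroup_val_hom _ _ hS)) /= => /eqP.
by rewrite divg_eq1 => /eqP.
Qed.

End CoverSection.

(** * Zero-sections and the cocycle [chi] *)

Section ZeroSection.
Variables (C : groupType -> Prop) (X : pgraph) (U : galois_cover C X) (j : X -> U).
Hypothesis hC : extension_closed_class C.
Hypothesis zj : zero_section j.

Let hU : hausdorff_space U. Proof. by case: (pg_profinite U). Qed.
Let cU : compact [set: U]. Proof. by case: (pg_profinite U). Qed.
Let zetaj m : zeta (j m) = m. Proof. by case: zj. Qed.
Let j0 m : j (gd false m) = gd false (j m). Proof. by case: zj. Qed.
Let cj : continuous j. Proof. by case: zj. Qed.

Lemma zeta_act a (x : U) : zeta (act a x) = zeta x.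
Proof. by apply/esym/zeta_orbit; exists a. Qed.

Lemma act_inj a b (x : U) : act a x = act b x -> a = b.
Proof.
move=> e; have := @act_free _ _ U (b^-1 * a) x.
rewrite act_M e -act_M mulVg act_1 => /(_ erefl) h.
by apply: (mulgI b^-1); rewrite h mulVg.
Qed.

Lemma chiE m : act (chi j m) (j (gd true m)) = gd true (j m).
Proof.
have : zeta (j (gd true m)) = zeta (gd true (j m)).
  by rewrite zetaj (zeta_morphism U).2 zetaj.
move=> /zeta_orbit [a e].
by apply: (@xgetPex _ 1 [set a | act a (j (gd true m)) = gd true (j m)]); exists a.
Qed.

Lemma chi_vertex m : vtx m -> chi j m = 1.
Proof.
move=> hm; apply: (@act_free _ _ U _ (j m)).
have hj : vtx (j m) by rewrite -(gd_id false hm) j0; exact: gd_vtx.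
by have := chiE m; rewrite !gd_id.
Qed.

(* The covering [U] is the disjoint union of the translates of [j X]. *)
Lemma sheet_exists : exists tau : U -> cgrp U, [/\ continuous tau,
  forall x, x = act (tau x) (j (zeta x)) & forall a m, tau (act a (j m)) = a].
Proof.
have [|tau htau] := @boolp.choice _ _ (fun (x : U) a => x = act a (j (zeta x))).
  by move=> x; apply/zeta_orbit; rewrite zetaj.
exists tau; split=> //; last first.
  by move=> a m; apply: (@act_inj _ _ (j m)); rewrite {2}[act a _]htau zeta_act zetaj.
(* The action is continuous and the covering group is compact, so a closed equation for the graph of
   [tau] is enough. *)
apply: closed_graph_continuous => //.
  exact: (proC_compact hC (cgrp_proC U)).
have -> : [set p : U * cgrp U | tau p.1 = p.2] =
    [set p | p.1 = act p.2 (j (zeta p.1))].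
  apply/seteqP; split=> [[x a] /= <- //|[x a] /= e].
  by apply: (@act_inj _ _ (j (zeta x))); rewrite -htau -e.
apply: closed_eq => //; first exact: continuous_fst.
apply: (@continuous_then _ _ _ (fun p : U * cgrp U => (p.2, j (zeta p.1)))
  (fun p : cgrp U * U => act p.1 p.2)); last exact: act_continuous.
apply: continuous_pair; first exact: continuous_snd.
apply: (@continuous_then _ _ _ (fun p : U * cgrp U => zeta p.1)) => //.
apply: (@continuous_then _ _ _ (@fst U (cgrp U)) (@zeta _ _ U)).
  exact: continuous_fst.
exact: (zeta_morphism U).1.
Qed.

Lemma chi_continuous : continuous (chi j).
Proof.
have [tau [ctau _ tauE]] := sheet_exists.
have -> : chi j = fun m => tau (gd true (j m)).
  by apply/funext => m; rewrite -chiE tauE.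
apply: (@continuous_then _ _ _ (fun m => gd true (j m))) => //.
by apply: (@continuous_then _ _ _ j (gd true)) => //; exact: gd_continuous.
Qed.

Variable v : X.
Hypothesis conU : connected_graph U.

(** Let [r] be the primitive on [U] of the pulled-back cocycle, normalised to 1 at [j v]. By
    connectedness [r (act a x) * (r x)^-1] does not depend on [x]; this monodromy is the
    homomorphism [c], and [w] is [r] along the section. *)
Lemma cocycle_extends (H : groupType) (t : X -> H) :
  (forall D : galois_cover C U, connected_graph D -> injective (zeta (g := D))) ->
  C H -> locally_constant t -> (forall m, vtx m -> t m = 1) ->
  exists (c : cgrp U -> H) (w : X -> H), [/\ lc_hom c, locally_constant w, w v = 1 &
    forall m, c (chi j m) = w (gd false m) * t m * (w (gd true m))^-1].
Proof.
move=> univ CH lt t1.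
have czeta : continuous (@zeta _ _ U) := (zeta_morphism U).1.
have lt' := locally_constant_pre czeta lt.
have [|s [ls s0 s1]] := cocycle_trivial hC CH conU lt' _ univ.
  by move=> x hx; apply: t1; exact: (graph_morphism_vertex (zeta_morphism U)).
pose r x := (s (j v))^-1 * s x.
have lr : locally_constant r := locally_constant_post (mul (s (j v))^-1) ls.
have r0 x : r (gd false x) = r x by rewrite /r s0.
have r1 x : r (gd true x) = r x * t (zeta x) by rewrite /r s1 mulgA.
have rv : r (j v) = 1 by rewrite /r mulVg.
have cact a : continuous (act a : U -> U).
  apply: (@continuous_then _ _ _ (fun x : U => (a, x))
    (fun p : cgrp U * U => act p.1 p.2)); last exact: act_continuous.
  by apply: continuous_pair => x; [exact: cvg_cst|exact: cvg_id].
have ract a x : r (act a x) = r (act a (j v)) * r x.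
  have := connected_graph_constant (c := fun x => r (act a x) * (r x)^-1) conU _ _ x (j v).
  rewrite rv invg1 mulg1 => <- //; first by rewrite mulgVK.
    exact: (locally_constant_post (fun s => s.1 * s.2^-1)
      (locally_constant_pair (locally_constant_pre (@cact a) lr) lr)).
  move=> [] y; rewrite -act_gd ?r0 // !r1 zeta_act invgM mulgA mulgK //.
exists (fun a => r (act a (j v))), (fun m => r (j m)); split=> //.
- split; last by move=> a b; rewrite act_M ract.
  apply: (locally_constant_pre (f := fun a : cgrp U => act a (j v))) lr.
  apply: (@continuous_then _ _ _ (fun a : cgrp U => (a, j v))
    (fun p : cgrp U * U => act p.1 p.2)); last exact: act_continuous.
  by apply: continuous_pair => x; [exact: cvg_id|exact: cvg_cst].
- exact: locally_constant_pre lr.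
- move=> m; have := ract (chi j m) (j (gd true m)); rewrite chiE r1 zetaj => e.
  by rewrite j0 r0 e mulgK.
Qed.

(** The function [c (tau x) * w (zeta x) * (c' (tau x))^-1] is unchanged along edges of [U], hence
    equal to its value 1 at [j v]. On the section it reads [w = 1], and on the fibre over [v] it
    reads [c = c']. *)
Lemma cocycle_unique (H : groupType) (c c' : cgrp U -> H) (w : X -> H) :
  lc_hom c -> lc_hom c' -> locally_constant w -> w v = 1 ->
  (forall m, w (gd false m) = w m) ->
  (forall m, c' (chi j m) = (w (gd false m))^-1 * c (chi j m) * w (gd true m)) ->
  c = c' /\ forall m, w m = 1.
Proof.
move=> [lc hc] [lc' hc'] lw wv w0 e.
have [tau [ctau htau tauE]] := sheet_exists.
have tau0 x : tau (gd false x) = tau x.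
  by rewrite {1}[x]htau act_gd -j0 tauE.
have tau1 x : tau (gd true x) = tau x * chi j (zeta x).
  by rewrite {1}[x]htau act_gd -chiE -act_M tauE.
have czeta : continuous (@zeta _ _ U) := (zeta_morphism U).1.
have tauj m : tau (j m) = 1 by rewrite -[j m]act_1 tauE.
have const x : c (tau x) * w (zeta x) * (c' (tau x))^-1 = 1.
  pose f y := c (tau y) * w (zeta y) * (c' (tau y))^-1.
  have <- : f (j v) = 1.
    by rewrite /f tauj zetaj wv (hom1 hc) (hom1 hc') invg1 !mulg1.
  apply: (connected_graph_constant (c := f) conU).
    apply: (locally_constant_post (fun s => s.1.1 * s.1.2 * s.2^-1)
      (locally_constant_pair (locally_constant_pair
        (locally_constant_pre ctau lc) (locally_constant_pre czeta lw))
        (locally_constant_pre ctau lc'))).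
  move=> [] y; rewrite /f (zeta_morphism U).2; last by rewrite tau0 w0.
  by rewrite tau1 hc hc' e w0 !invgM invgK !mulgA !mulgK.
have w1 m : w m = 1.
  by have := const (j m); rewrite tauj zetaj (hom1 hc) (hom1 hc') invg1 mulg1 mul1g.
split=> //; apply/funext => a.
have := const (act a (j v)); rewrite tauE w1 mulg1 => /eqP.
by rewrite divg_eq1 => /eqP.
Qed.

End ZeroSection.

Lemma finite_hausdorff_zero_dimensional (T : topologicalType) :
  finite_set [set: T] -> hausdorff_space T -> zero_dimensional T.
Proof.
move=> fT hT x y xy; exists [set x]; split=> //; last by move/eqP: xy => ne e; exact: ne.
split; last exact: finite_hausdorff_closed.
by rewrite -closedC; exact: finite_hausdorff_closed.
Qed.

Lemma limit_separated_above (I : Type) (le : I -> I -> Prop)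
    (X : I -> topologicalType) (phi : forall i j, X j -> X i)
    (L : topologicalType) (p : forall i, L -> X i) (i0 : I) (x y : L) :
  directed_poset le -> inverse_limit le phi p ->
  (forall i, le i0 i -> p i x = p i y) -> x = y.
Proof.
move=> dI limL e; apply: (limit_separated limL) => i.
have [k [ik0 ik]] := dp_directed dI i0 i.
by rewrite -((il_cone limL).2 i k ik x) -((il_cone limL).2 i k ik y) e.
Qed.

Lemma inc_mul_eq (GG : pgog) (m n : base GG) (g h : fib m) (a b : fib n) :
  inc g = inc a -> inc h = inc b -> inc (g * h) = inc (a * b).
Proof.
move=> eg; have emn : m = n by rewrite -(gpi_inc g) eg gpi_inc.
by subst n => eh; rewrite (inc_injective eg) (inc_injective eh).
Qed.

(** * Descent to the finite levels *)

Section Decomposition.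
Variables (C : groupType -> Prop) (GG : pgog) (D : finite_decomposition C GG).
Local Notation I := (fd_I D).
Local Notation le := (@fd_le C GG D).
Local Notation G := (@fd_gog C GG D).
Local Notation tr := (fd_tr D).
Local Notation tr' := (fd_tr' D).
Local Notation proj := (fd_proj D).
Local Notation proj' := (fd_proj' D).

Let dI : directed_poset le := fd_directed D.
Let ftot i : finite_set [set: tot (G i)]. Proof. by case: (fd_finite (f := D) i). Qed.
Let fbase i : finite_set [set: base (G i)]. Proof. by case: (fd_finite (f := D) i). Qed.
Let htot i : hausdorff_space (tot (G i)). Proof. by case: (tot_profinite (G i)). Qed.
Let hbase i : hausdorff_space (base (G i)). Proof. by case: (pg_profinite (base (G i))). Qed.
Let ctot i : compact [set: tot (G i)]. Proof. exact: finite_compact. Qed.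
Let cbase i : compact [set: base (G i)]. Proof. exact: finite_compact. Qed.
Let stot := il_system (fd_limit D).
Let sbase := il_system (fd_limit' D).

Lemma fd_base_connected i : abstractly_connected (base (G i)).
Proof.
apply: (base_connected (f := id)) => //; first by split=> // x; exact: cvg_id.
Qed.

Lemma proj_tr i j x : le i j -> tr i j (proj j x) = proj i x.
Proof. by move=> ij; exact: (il_cone (fd_limit D)).2. Qed.

Lemma proj_tr' i j x : le i j -> tr' i j (proj' j x) = proj' i x.
Proof. by move=> ij; exact: (il_cone (fd_limit' D)).2. Qed.

Lemma tr_tr i j k x : le i j -> le j k -> tr i j (tr j k x) = tr i k x.
Proof. by move=> ij jk; exact: (sys_comp stot). Qed.

Lemma tr_tr' i j k x : le i j -> le j k -> tr' i j (tr' j k x) = tr' i k x.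
Proof. by move=> ij jk; exact: (sys_comp sbase). Qed.

Lemma proj_morph i : gog_morphism (proj i) (proj' i). Proof. exact: fd_proj_morphism. Qed.
Lemma tr_morph i j : le i j -> gog_morphism (tr i j) (tr' i j).
Proof. exact: fd_tr_morphism. Qed.

Lemma morph_gpi (X Y : pgog) (al : tot X -> tot Y) al' :
  gog_morphism al al' -> forall x, gpi (al x) = al' (gpi x).
Proof. by case. Qed.

Lemma morph_bd (X Y : pgog) (al : tot X -> tot Y) al' :
  gog_morphism al al' -> forall b x, al (bd b x) = bd b (al x).
Proof. by case. Qed.

Lemma morph_vtx (X Y : pgog) (al : tot X -> tot Y) al' :
  gog_morphism al al' -> forall m, vtx m -> vtx (al' m).
Proof. by case=> _ h _ _ _ m; exact: graph_morphism_vertex. Qed.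

(** Being a vertex means being fixed by [gd false], an equation that can be checked level by
    level. *)
Lemma vtx_of_proj i0 (m : base GG) :
  (forall i, le i0 i -> vtx (proj' i m)) -> vtx m.
Proof.
move=> h; suff <- : gd false m = m by exact: gd_vtx.
apply: (limit_separated_above dI (fd_limit' D) (i0 := i0)) => i ii.
have [_ [_ e] _ _ _] := proj_morph i.
by rewrite e gd_id //; exact: h.
Qed.

(** Every subset of a finite level is closed, and emptiness passes to all later levels because the
    transition maps carry [W] down. *)
Lemma eventually_base i0 (W : forall i, set (base (G i))) :
  (forall i j, le i0 i -> le i j -> forall m, W j m -> W i (tr' i j m)) ->
  (forall m, exists2 i, le i0 i & ~ W i (proj' i m)) ->
  exists2 i, le i0 i & forall j, le i j -> forall m, ~ W j m.
Proof.
move=> sW nW.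
have [||i ii nWi] := @eventually_empty _ _ dI _ _ sbase cbase hbase i0 W _ sW.
- by move=> i _; exact: finite_hausdorff_closed.
- by move=> x ex; have [m em] := limit_of_compatible (fd_limit' D) ex;
    have [i ii] := nW m; exists i; rewrite // -em.
by exists i => // j ij m /(sW _ _ ii ij); exact: nWi.
Qed.

Lemma eventually_tot i0 (W : forall i, set (tot (G i))) :
  (forall i j, le i0 i -> le i j -> forall m, W j m -> W i (tr i j m)) ->
  (forall m, exists2 i, le i0 i & ~ W i (proj i m)) ->
  exists2 i, le i0 i & forall j, le i j -> forall m, ~ W j m.
Proof.
move=> sW nW.
have [||i ii nWi] := @eventually_empty _ _ dI _ _ stot ctot htot i0 W _ sW.
- by move=> i _; exact: finite_hausdorff_closed.
- by move=> x ex; have [m em] := limit_of_compatible (fd_limit D) ex;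
    have [i ii] := nW m; exists i; rewrite // -em.
by exists i => // j ij m /(sW _ _ ii ij); exact: nWi.
Qed.

(** Products exist only within a fibre, so failures are recorded as triples [(g, h, g * h)]. The
    first two entries of a thread of such triples lie in a common fibre in the limit, and the third
    is their product. *)
Lemma eventually_fibre_hom i0 (H : groupType) (b : tot (G i0) -> H) :
  fibre_hom (fun x => b (proj i0 x)) ->
  exists2 i, le i0 i & forall j, le i j -> fibre_hom (fun x => b (tr i0 j x)).
Proof.
move=> hb; pose T i := (tot (G i) * tot (G i) * tot (G i))%type.
pose W i : set (T i) := [set z | exists m (g h : fib m),
  [/\ z.1.1 = inc g, z.1.2 = inc h, z.2 = inc (g * h) &
      b (tr i0 i (inc (g * h))) <> b (tr i0 i (inc g)) * b (tr i0 i (inc h))]].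
have sT := inverse_system_prod (inverse_system_prod stot stot) stot.
have sW i j : le i0 i -> le i j -> forall z, W j z ->
    W i ((tr i j z.1.1, tr i j z.1.2), tr i j z.2).
  move=> ii ij [[x y] z] [m [g [h [/= -> -> -> ne]]]].
  have [_ _ _ fal _] := tr_morph ij; have [f [hf ef]] := fal m.
  exists (tr' i j m), (f g), (f h); rewrite -hf -!ef; split=> //.
  by rewrite !tr_tr.
have [|||||i ii nW] := @eventually_empty _ _ dI _ _ sT _ _ i0 W.
- by move=> i; do 2![apply: compact_setTX => //].
- by move=> i; do 2![apply: hausdorff_prod => //].
- move=> i _; apply: finite_hausdorff_closed.
    by rewrite -!setXTT; do 2![apply: finite_setX => //].
  by do 2![apply: hausdorff_prod => //].
- exact: sW.
- move=> z ez.
  have [x ex] := limit_of_compatible (fd_limit D) (fun i j ij => congr1 (fun u => u.1.1) (ez i j ij)).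
  have [y ey] := limit_of_compatible (fd_limit D) (fun i j ij => congr1 (fun u => u.1.2) (ez i j ij)).
  have [w ew] := limit_of_compatible (fd_limit D) (fun i j ij => congr1 (fun u => u.2) (ez i j ij)).
  apply: contrapT => nex.
  have Wz i : le i0 i -> W i (z i).
    by move=> ii; apply: contrapT => nWi; apply: nex; exists i.
  have exy : gpi x = gpi y.
    apply: (limit_separated_above dI (fd_limit' D) (i0 := i0)) => i ii.
    have [m [g [h [e1 e2 _ _]]]] := Wz i ii.
    rewrite -!(morph_gpi (proj_morph i)).
    by move: (ex i) (ey i) => -> ->; rewrite e1 e2 !gpi_inc.
  have [g eg] := inc_surj x; have [h0 eh0] := inc_surj y.
  have [h eh] : exists h : fib (gpi x), inc h = y by rewrite exy; exists h0.
  have egh : w = inc (g * h).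
    apply: (limit_separated_above dI (fd_limit D) (i0 := i0)) => i ii.
    have [m [g' [h' [e1 e2 e3 _]]]] := Wz i ii.
    have [_ _ _ fal _] := proj_morph i; have [f [hf ef]] := fal (gpi x).
    rewrite ew e3 ef hf; apply: inc_mul_eq; rewrite -ef.
      by rewrite eg ex e1.
    by rewrite eh ey e2.
  have [m [g' [h' [e1 e2 e3]]]] := Wz i0 (dp_refl dI i0).
  rewrite -e1 -e2 -e3 !(sys_id stot) -ew -ey -ex.
  by have := hb (gpi x) g h; rewrite /= -egh eg eh.
exists i => // j ij m g h; apply: contrapT => ne.
apply: (nW _ (sW i j ii ij ((inc g, inc h), inc (g * h)) _)).
by exists m, g, h.
Qed.

Lemma lc_base_descends (S : Type) (s0 : S) (h : base GG -> S) :
  locally_constant h -> exists i (g : base (G i) -> S), forall x, h x = g (proj' i x).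
Proof.
move=> lh; have [|i [g [_ e]]] :=
  limit_locally_constant dI cbase _ (fd_limit' D) s0 lh.
  by move=> i; exact: finite_hausdorff_zero_dimensional.
by exists i, g.
Qed.

Lemma lc_tot_descends (S : Type) (s0 : S) (h : tot GG -> S) :
  locally_constant h -> exists i (g : tot (G i) -> S), forall x, h x = g (proj i x).
Proof.
move=> lh; have [|i [g [_ e]]] :=
  limit_locally_constant dI ctot _ (fd_limit D) s0 lh.
  by move=> i; exact: finite_hausdorff_zero_dimensional.
by exists i, g.
Qed.

Lemma lc_of_base i (S : Type) (g : base (G i) -> S) :
  locally_constant (fun x => g (proj' i x)).
Proof.
apply: (locally_constant_pre ((il_cone (fd_limit' D)).1 i)).
exact: finite_hausdorff_locally_constant.
Qed.

Lemma lc_of_tot i (S : Type) (g : tot (G i) -> S) :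
  locally_constant (fun x => g (proj i x)).
Proof.
apply: (locally_constant_pre ((il_cone (fd_limit D)).1 i)).
exact: finite_hausdorff_locally_constant.
Qed.

Lemma specialisation_descends (H : groupType) (b : tot GG -> H) (t : base GG -> H) :
  locally_constant b -> locally_constant t -> fibre_hom b ->
  (forall x, b (bd false x) = t (gpi x) * b (bd true x) * (t (gpi x))^-1) ->
  (forall m, vtx m -> t m = 1) ->
  exists i (Phi : Fgroup (G i) -> H), [/\ is_hom Phi,
    forall x, vtx (gpi x) -> Phi (Fvertex (proj i x)) = b x &
    forall m, Phi (Fedge (proj' i m) true) = t m].
Proof.
move=> lb lt hb hbt t1.
have [i1 [b1 eb1]] := lc_tot_descends 1 lb.
have [i2 [t2 et2]] := lc_base_descends 1 lt.
have [i0 [l1 l2]] := dp_directed dI i1 i2.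
pose b0 x := b1 (tr i1 i0 x); pose t0 m := t2 (tr' i2 i0 m).
have eb x : b x = b0 (proj i0 x) by rewrite /b0 proj_tr.
have et m : t m = t0 (proj' i0 m) by rewrite /t0 proj_tr'.
have [|j1 ij1 h1] := @eventually_fibre_hom i0 H b0.
  by have -> : (fun x => b0 (proj i0 x)) = b by apply/funext.
pose W i := [set x : tot (G i) | b0 (tr i0 i (bd false x)) <>
  t0 (tr' i0 i (gpi x)) * b0 (tr i0 i (bd true x)) * (t0 (tr' i0 i (gpi x)))^-1].
have [||j2 ij2 h2] := @eventually_tot i0 W.
- move=> i j ii ij x; rewrite /W /= (morph_gpi (tr_morph ij)).
  by rewrite -!(morph_bd (tr_morph ij)) !tr_tr // tr_tr'.
- move=> x; exists i0; first exact: (dp_refl dI); apply.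
  rewrite (morph_gpi (proj_morph i0)) -!(morph_bd (proj_morph i0)).
  by rewrite !(sys_id stot) !(sys_id sbase) -!eb -!et.
(* An edge of the limit may project to a vertex, where [Fedge] is 1. Its value [t m] is then matched
   only if [t0] is already 1 on all vertices of the level. *)
pose V i := [set m : base (G i) | vtx m /\ t0 (tr' i0 i m) <> 1].
have [||j3 ij3 h3] := @eventually_base i0 V.
- move=> i j ii ij m [hm ne]; split; first exact: (morph_vtx (tr_morph ij)).
  by rewrite tr_tr'.
- move=> m; apply: contrapT => nex.
  have Vm i : le i0 i -> V i (proj' i m).
    by move=> ii; apply: contrapT => nV; apply: nex; exists i.
  have hm : vtx m by apply: (vtx_of_proj (i0 := i0)) => i /Vm [].
  by have [_] := Vm i0 (dp_refl dI i0); apply; rewrite (sys_id sbase) -et t1.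
have [k0 [l3 l4]] := dp_directed dI j1 j2.
have [k [l5 l6]] := dp_directed dI k0 j3.
have ik : le i0 k by apply: dp_trans l6.
have h3' m : vtx m -> t0 (tr' i0 k m) = 1.
  by move=> hm; apply: contrapT => ne; apply: (h3 k l6 m).
have [||Phi [hPhi Pv Pe]] := @Fgroup_universal (G k) H
  (fun x => b0 (tr i0 k x)) (fun m => t0 (tr' i0 k m)).
- by move=> m _; apply: h1; apply: dp_trans l5.
- by move=> x; apply: contrapT; apply: (h2 k); apply: dp_trans l5.
exists k, Phi; split=> // [x hx|m].
  rewrite Pv ?proj_tr -?eb //.
  by rewrite (morph_gpi (proj_morph k)); exact: (morph_vtx (proj_morph k)).
have [hm|hm] := pselect (vtx (proj' k m)); last by rewrite Pe // proj_tr' -?et.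
by rewrite Fedge_vertex // (hom1 hPhi) et -(proj_tr' _ ik) h3'.
Qed.

End Decomposition.

(** * The correspondence between homomorphisms *)

Section Comparison.
Variables (C : groupType -> Prop) (GG : pgog) (v : base GG).
Hypothesis hC : extension_closed_class C.
Hypothesis hv : vtx v.

Variable D : finite_decomposition C GG.
Local Notation le := (@fd_le C GG D).
Local Notation G := (@fd_gog C GG D).
Local Notation tr := (fd_tr D).
Local Notation tr' := (fd_tr' D).
Local Notation proj := (fd_proj D).
Local Notation proj' := (fd_proj' D).

Variables (P : topGroupType) (Ph : fd_I D -> topGroupType).
Variables (iota : forall i, pi1 (proj' i v) -> Ph i).
Variables (f : forall i j, Ph j -> Ph i) (p : forall i, P -> Ph i).
Arguments f : clear implicits.
Hypothesis cpl : forall i, is_proC_completion C (iota (i := i)).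
Hypothesis hf : forall i j, le i j -> continuous_hom (f i j) /\
  exists a : pi1 (proj' j v) -> pi1 (proj' i v),
    induced_map (tr i j) (tr' i j) a /\
    (forall x, f i j (iota x) = iota (a x)).
Hypothesis hp : forall i, is_hom (p i).
Hypothesis limP : inverse_limit le f p.

Variables (Q : topGroupType) (nu : tot GG -> Q).
Variables (U : galois_cover C (base GG)) (j : base GG -> U) (nu' : cgrp U -> Q).
Hypothesis uU : universal_cover U.
Hypothesis zj : zero_section j.
Hypothesis specQ : universal_J_specialisation j nu nu'.

Let dI : directed_poset le := fd_directed D.
Let sysP := il_system limP.
Let cPh i : compact [set: Ph i] := completion_compact hC (cpl i).
Let zPh i : zero_dimensional (Ph i) := completion_zero_dimensional (cpl i).
Let hPh i : hausdorff_space (Ph i) := zero_dimensional_hausdorff (@zPh i).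
Let hvi i : vtx (proj' i v) := morph_vtx (proj_morph i) hv.
Let fhom i k : le i k -> is_hom (f i k).
Proof. by move=> /hf [[]]. Qed.

Lemma pi1_of_path i (x : pi1 (proj' i v)) :
  exists2 c, closed_path (proj' i v) c & pi1_val x = path_elt c.
Proof. by case: x => x /= /asboolP. Qed.

Definition level_data (H : groupType) i (Phi : Fgroup (G i) -> H) (al : Ph i -> H) :=
  [/\ is_hom Phi, lc_hom al & forall x, al (iota x) = Phi (pi1_val x)].

(** The gauge is 1 at the base point, so it leaves the values on pi_1 alone and [al] need only be
    composed with the transition map. *)
Lemma raise_level (H : groupType) i k (Phi : Fgroup (G i) -> H) (al : Ph i -> H)
    (u : base (G k) -> H) :
  le i k -> level_data Phi al -> u (proj' k v) = 1 ->
  exists Psi : Fgroup (G k) -> H,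
    [/\ level_data Psi (fun y => al (f i k y)),
      forall x, vtx (gpi x) -> Psi (Fvertex x) =
        u (gpi x) * Phi (Fvertex (tr i k x)) * (u (gpi x))^-1 &
      forall m, Psi (Fedge m true) =
        u (gd false m) * Phi (Fedge (tr' i k m) true) * (u (gd true m))^-1].
Proof.
move=> ik [hPhi lal e] uv.
have [Psi [hPsi Pv Pe Pp]] := Fgroup_pullback (tr_morph ik) u hPhi.
have [cf [a [ia ea]]] := hf ik.
exists Psi; split=> //; split=> //; first exact: lc_hom_pre lal.
move=> x; rewrite ea e; have [c [c1 c2] ec] := pi1_of_path x.
by rewrite (ia x c) // ec (Pp _ _ _ (hvi k) c1 c2) uv mul1g invg1 mulg1.
Qed.

(* For each [H] in [C] this relation is the graph of a bijection between the
   homomorphisms from [P] and those from [Q]. *)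
Definition corresponds (H : groupType) (phi : P -> H) (psi : Q -> H) :=
  exists i (Phi : Fgroup (G i) -> H) (al : Ph i -> H),
  [/\ level_data Phi al, forall y, phi y = al (p i y),
    forall x, vtx (gpi x) -> psi (nu x) = Phi (Fvertex (proj i x)) &
    forall m, psi (nu' (chi j m)) = Phi (Fedge (proj' i m) true)].

Lemma corresponds_natural (H K : groupType) (phi : P -> H) (psi : Q -> H)
    (k : H -> K) : is_hom k -> corresponds phi psi ->
  corresponds (fun x => k (phi x)) (fun x => k (psi x)).
Proof.
move=> hk [i [Phi [al [[hPhi lal e] e1 e2 e3]]]].
exists i, (fun x => k (Phi x)), (fun x => k (al x)); split=> [|y|x hx|m].
- split; [exact: hom_comp|exact: lc_hom_post|by move=> x; rewrite e].
- by rewrite e1.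
- by rewrite e2.
- by rewrite e3.
Qed.

Lemma corresponds_above (H : groupType) (phi : P -> H) (psi : Q -> H) i k
    (Phi : Fgroup (G i) -> H) (al : Ph i -> H) :
  le i k -> level_data Phi al -> (forall y, phi y = al (p i y)) ->
  (forall x, vtx (gpi x) -> psi (nu x) = Phi (Fvertex (proj i x))) ->
  (forall m, psi (nu' (chi j m)) = Phi (Fedge (proj' i m) true)) ->
  exists Psi : Fgroup (G k) -> H,
    [/\ level_data Psi (fun y => al (f i k y)),
      forall y, phi y = al (f i k (p k y)),
      forall x, vtx (gpi x) -> psi (nu x) = Psi (Fvertex (proj k x)) &
      forall m, psi (nu' (chi j m)) = Psi (Fedge (proj' k m) true)].
Proof.
move=> ik ld e1 e2 e3.
have [Psi [ld' Pv Pe]] := raise_level (u := fun=> 1) ik ld erefl.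
exists Psi; split=> // [y|x hx|m].
- by rewrite (il_cone limP).2.
- rewrite Pv ?mul1g ?invg1 ?mulg1 ?proj_tr ?e2 //.
  rewrite (morph_gpi (proj_morph k)); exact: (morph_vtx (proj_morph k)).
- by rewrite Pe mul1g invg1 mulg1 proj_tr' // e3.
Qed.

Lemma specialisation_comp (H : groupType) (psi : Q -> H) : lc_hom psi ->
  J_specialisation j (H := discrete_topology H)
    (fun x => psi (nu x)) (fun a => psi (nu' a)).
Proof.
move=> [lpsi hpsi]; have [[cnu fnu [cnu' hnu'] enu] _] := specQ.
split.
- by apply/(@locally_constantP _ H); exact: locally_constant_pre lpsi.
- by move=> m x y; rewrite fnu hpsi.
- split; last by move=> x y; rewrite hnu' hpsi.
  by apply/(@locally_constantP _ H); exact: locally_constant_pre lpsi.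
- move=> x; have [e1 e2] := enu x; split; first by rewrite {1}e1.
  by rewrite {1}e2 !hpsi (homV _ hpsi).
Qed.

Lemma lc_hom_discrete (L : topGroupType) (H : groupType) (g : L -> H) :
  lc_hom g <-> continuous_hom (g : L -> discrete_topology H).
Proof.
by split=> -[h1 h2]; split=> //; apply/(@locally_constantP _ H).
Qed.

Lemma specialisation_unique (H : groupType) (psi psi' : Q -> H) : C H ->
  lc_hom psi -> lc_hom psi' ->
  (forall x, psi (nu x) = psi' (nu x)) ->
  (forall a, psi (nu' a) = psi' (nu' a)) -> psi = psi'.
Proof.
move=> CH lpsi lpsi' e e'.
have [_ univ] := specQ.
have [d [_ ud]] := univ _ _ _ (proC_discrete CH) (specialisation_comp lpsi).
have <- : d = psi by apply: ud; split=> //; exact/lc_hom_discrete.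
apply: ud; split; first exact/lc_hom_discrete.
- by apply/funext => x; rewrite /= e.
- by apply/funext => x; rewrite /= e'.
Qed.

Lemma psi_chi_lc (H : groupType) (psi : Q -> H) : lc_hom psi ->
  lc_hom (fun a => psi (nu' a)) /\ locally_constant (fun m => psi (nu' (chi j m))).
Proof.
move=> lpsi; have [[_ _ hnu' _] _] := specQ.
have l := lc_hom_pre hnu' lpsi; split=> //.
exact: (locally_constant_pre (chi_continuous hC zj) l.1).
Qed.

Lemma corresponds_ex_P (H : groupType) (psi : Q -> H) : C H -> lc_hom psi ->
  exists2 phi : P -> H, lc_hom phi & corresponds phi psi.
Proof.
move=> CH lpsi; have [sb sf [sc sh] se] := specialisation_comp lpsi.
have [[_ hc] lchi] := psi_chi_lc lpsi.
have [||||i [Phi [hPhi Pv Pe]]] := @specialisation_descends C GG D H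
  (fun x => psi (nu x)) (fun m => psi (nu' (chi j m))) _ lchi.
- exact/(@locally_constantP _ H).
- exact: sf.
- by move=> x; have [<- ] := se x.
- by move=> m hm; rewrite (chi_vertex zj hm) (hom1 hc).
have [al lal eal] : exists2 al : Ph i -> H, lc_hom al & forall x, al (iota x) = Phi (pi1_val x).
  by apply: (completion_extend hC (cpl i) CH) => x y; rewrite -hPhi -[RHS]/(Phi (pi1_val (x * y))).
exists (fun y => al (p i y)).
  by apply: lc_hom_pre lal; split=> //; exact: (il_cone limP).1.
by exists i, Phi, al; split=> // x /Pv ->.
Qed.

Lemma corresponds_ex_Q (H : groupType) (phi : P -> H) : C H -> lc_hom phi ->
  exists2 psi : Q -> H, lc_hom psi & corresponds phi psi.
Proof.
move=> CH [lphi hphi].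
have [i [al [lal hal eal]]] := limit_hom_factor dI cPh zPh limP fhom hp lphi hphi.
have hai : is_hom (fun x : pi1 (proj' i v) => al (iota x)).
  by apply: hom_comp hal; exact: (completion_hom (cpl i)).
have [Phi hPhi ePhi] := pi1_hom_extends (hvi i) (@fd_base_connected C GG D i) hai.
have ld : level_data Phi al by split.
have [||c [w [lc lw wv ec]]] := @cocycle_extends C (base GG) U j hC zj v uU.1 H
  (fun m => Phi (Fedge (proj' i m) true)) uU.2 CH.
- exact: (lc_of_base (fun m => Phi (Fedge m true))).
- by move=> m hm; rewrite Fedge_vertex ?(hom1 hPhi) //; exact: (morph_vtx (proj_morph i)).
(* [Psi] lives on the abstract group F of the profinite graph of groups itself; continuity is
   recovered afterwards from the factorisation through level [i] and the local constancy of [w]. *)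
have [Psi [hPsi Pv Pe _]] := Fgroup_pullback (proj_morph i) w hPhi.
have [fb eb] := Fgroup_specialisation hPsi.
have lb : locally_constant (fun x => Psi (Fvertex (bd false x))).
  have -> : (fun x => Psi (Fvertex (bd false x))) = fun x =>
      w (gpi (bd false x)) * Phi (Fvertex (bd false (proj i x))) * (w (gpi (bd false x)))^-1.
    by apply/funext => x; rewrite Pv ?(morph_bd (proj_morph i)) //; exact: bd_vertex.
  have l1 : locally_constant (fun x => w (gpi (bd false x))).
    apply: (locally_constant_pre (f := fun x => gpi (bd false x))) lw.
    by apply: (continuous_then (@bd_continuous GG false)); exact: gpi_continuous.
  have l2 := lc_of_tot (D := D) (fun x : tot (G i) => Phi (Fvertex (bd false x))).
  exact: (locally_constant_post (fun s => s.1 * s.2 * s.1^-1) (locally_constant_pair l1 l2)).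
have [_ univ] := specQ.
have spec : J_specialisation j (H := discrete_topology H)
    (fun x => Psi (Fvertex (bd false x))) c.
  split=> //.
  - exact/(@locally_constantP _ H).
  - exact/lc_hom_discrete.
  - by move=> x; rewrite ec -Pe; exact: eb.
have [psi [[cpsi epsi epsi'] _]] := univ _ _ _ (proC_discrete CH) spec.
exists psi; first exact/lc_hom_discrete.
(* The correspondence is witnessed at a finite level, so the gauge has to descend to one as well. *)
have [i' [w' ew']] := lc_base_descends D 1 lw.
have [k [ik ik']] := dp_directed dI i i'.
pose wk (m : base (G k)) := w' (tr' i' k m).
have ewk m : wk (proj' k m) = w m by rewrite /wk proj_tr' // ew'.
have [Psi' [ld' Pv' Pe']] := raise_level (u := wk) ik ld (etrans (ewk v) wv).
exists k, Psi', (fun y => al (f i k y)); split=> // [y|x hx|m].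
- by rewrite eal (il_cone limP).2.
- have -> : psi (nu x) = Psi (Fvertex (bd false x)).
    exact: (congr1 (@^~ x) (esym epsi)).
  rewrite bd_id // Pv // Pv' (morph_gpi (proj_morph k)).
    by rewrite proj_tr // ewk.
  exact: (morph_vtx (proj_morph k)).
- have -> : psi (nu' (chi j m)) = c (chi j m).
    exact: (congr1 (@^~ (chi j m)) (esym epsi')).
  rewrite Pe' ec proj_tr' // -!ewk.
  by have [_ [_ e] _ _ _] := proj_morph k; rewrite !e.
Qed.

Lemma corresponds_unique_Q (H : groupType) (phi : P -> H) (psi psi' : Q -> H) :
  C H -> lc_hom psi -> lc_hom psi' ->
  corresponds phi psi -> corresponds phi psi' -> psi = psi'.
Proof.
move=> CH lpsi lpsi' [i1 [Phi1 [al1 [ld1 e1 v1 h1]]]] [i2 [Phi2 [al2 [ld2 e2 v2 h2]]]].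
have [i [l1 l2]] := dp_directed dI i1 i2.
have [Psi1 [{}ld1 {}e1 {}v1 {}h1]] := corresponds_above l1 ld1 e1 v1 h1.
have [Psi2 [{}ld2 {}e2 {}v2 {}h2]] := corresponds_above l2 ld2 e2 v2 h2.
set b1 := (fun y => al1 (f i1 i y)) in ld1 e1.
set b2 := (fun y => al2 (f i2 i y)) in ld2 e2.
(* [b1] and [b2] agree on the image of [P], which need not be all of [Ph i]; compactness makes them
   agree on all of some later [Ph k]. *)
pose W k := [set y : Ph k | b1 (f i k y) <> b2 (f i k y)].
have [|||k ik nW] := @eventually_empty _ _ dI _ _ sysP cPh hPh i W.
- move=> k ik; have [cf _] := hf ik.
  have [_ [lb1 _] _] := ld1; have [_ [lb2 _] _] := ld2.
  exact: (@locally_constant_closed _ _ _ (fun s => s.1 <> s.2) (locally_constant_pair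
    (locally_constant_pre cf.1 lb1) (locally_constant_pre cf.1 lb2))).
- by move=> k l ik kl y; rewrite /W /= (sys_comp sysP).
- move=> y ey; have [z ez] := limit_of_compatible limP ey.
  exists i; first exact: (dp_refl dI); apply.
  by rewrite (sys_id sysP) -ez -[LHS]e1 -[RHS]e2.
have [Th1 [[hTh1 _ d1] _ w1 k1]] := corresponds_above ik ld1 e1 v1 h1.
have [Th2 [[hTh2 _ d2] _ w2 k2]] := corresponds_above ik ld2 e2 v2 h2.
have agree x : pi1_pred (proj' k v) x -> Th1 x = Th2 x.
  move=> hx; have := d1 (Pi1 hx); have := d2 (Pi1 hx) => /= <- <-.
  by apply: contrapT; exact: nW.
have [u [uv uV uE]] :=
  homs_agree_gauge (hvi k) (@fd_base_connected C GG D k) hTh1 hTh2 agree.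
have [_ [_ eproj] _ _ _] := proj_morph k.
(* The gauge [u] is meaningful at vertices only; an edge receives the value at its initial vertex,
   as [cocycle_unique] demands. *)
pose w m := u (proj' k (gd false m)).
have wE m : vtx m -> w m = u (proj' k m) by move=> hm; rewrite /w gd_id.
have [[lc _] [lc' _]] := (psi_chi_lc lpsi, psi_chi_lc lpsi').
have [||||ec w1'] := cocycle_unique hC zj uU.1 (w := w) (v := v) lc lc'.
- exact: (locally_constant_pre (@gd_continuous (base GG) false) (lc_of_base u)).
- by rewrite wE.
- by move=> m; rewrite /w gd_gd.
- by move=> m; rewrite /w !gd_gd k1 k2 uE !eproj.
apply: (specialisation_unique CH lpsi lpsi'); last first.
  by move=> a; exact: (congr1 (@^~ a) ec).
have ev x : vtx (gpi x) -> psi (nu x) = psi' (nu x).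
  move=> hx; rewrite w1 // w2 // uV (morph_gpi (proj_morph k)).
    by rewrite -wE // w1' invg1 mul1g mulg1.
  exact: (morph_vtx (proj_morph k)).
move=> x; have [[_ _ _ enu] _] := specQ.
by rewrite (enu x).1 ev //; exact: bd_vertex.
Qed.

Lemma corresponds_unique_P (H : groupType) (psi : Q -> H) (phi phi' : P -> H) :
  corresponds phi psi -> corresponds phi' psi -> phi = phi'.
Proof.
move=> [i1 [Phi1 [al1 [ld1 e1 v1 h1]]]] [i2 [Phi2 [al2 [ld2 e2 v2 h2]]]].
have [i [l1 l2]] := dp_directed dI i1 i2.
have [Psi1 [{}ld1 {}e1 {}v1 {}h1]] := corresponds_above l1 ld1 e1 v1 h1.
have [Psi2 [{}ld2 {}e2 {}v2 {}h2]] := corresponds_above l2 ld2 e2 v2 h2.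
set b1 := (fun y => al1 (f i1 i y)) in ld1 e1.
set b2 := (fun y => al2 (f i2 i y)) in ld2 e2.
(* [psi] determines [Psi1] and [Psi2] only on elements coming from the limit; agreement on a whole
   level is reached further up, for vertex elements by [W] and for edges by [V]. *)
pose W k := [set x : tot (G k) | vtx (gpi x) /\
  Psi1 (Fvertex (tr i k x)) <> Psi2 (Fvertex (tr i k x))].
have [||k1 ik1 nW] := @eventually_tot C GG D i W.
- move=> k l ik kl x [hx ne]; split; last by rewrite tr_tr.
  rewrite (morph_gpi (tr_morph kl)); exact: (morph_vtx (tr_morph kl)).
- move=> x; apply: contrapT => nex.
  have Wx k : le i k -> W k (proj k x).
    by move=> ik; apply: contrapT => nWk; apply: nex; exists k.
  have hx : vtx (gpi x).
    apply: (vtx_of_proj (i0 := i)) => k /Wx [].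
    by rewrite (morph_gpi (proj_morph k)).
  have [_] := Wx i (dp_refl dI i); apply.
  by rewrite (proj_tr x (dp_refl dI i)) -v1 // -v2.
pose V k := [set m : base (G k) |
  Psi1 (Fedge (tr' i k m) true) <> Psi2 (Fedge (tr' i k m) true)].
have [||k2 ik2 nV] := @eventually_base C GG D i V.
- by move=> k l ik kl m; rewrite /V /= tr_tr'.
- move=> m; exists i; first exact: (dp_refl dI); apply.
  by rewrite (proj_tr' m (dp_refl dI i)) -h1 -h2.
have [k [l3 l4]] := dp_directed dI k1 k2.
have ik : le i k by apply: dp_trans l3.
have [Th1 [[hTh1 la1 d1] tv1 te1]] := raise_level (u := fun=> 1) ik ld1 erefl.
have [Th2 [[hTh2 la2 d2] tv2 te2]] := raise_level (u := fun=> 1) ik ld2 erefl.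
have eTh : Th1 = Th2.
  apply: Fgroup_hom_ext => // [x hx|m].
    rewrite tv1 // tv2 //; congr (_ * _ * _).
    by apply: contrapT => ne; exact: (nW k l3 x).
  rewrite te1 te2; congr (_ * _ * _).
  by apply: contrapT => ne; exact: (nV k l4 m).
have eb : (fun y => b1 (f i k y)) = (fun y => b2 (f i k y)).
  by apply: (completion_dense hC (cpl k) la1 la2) => x; rewrite d1 d2 eTh.
apply/funext => y; rewrite [LHS]e1 [RHS]e2.
have h : b1 (f i k (p k y)) = b2 (f i k (p k y)) := congr1 (@^~ (p k y)) eb.
by rewrite ((il_cone limP).2 i k ik y) in h.
Qed.

End Comparison.

Theorem theorem3p9 (C : groupType -> Prop) (hC : extension_closed_class C)
    (GG : pgog) (hGG : proC_gog C GG) (hinj : injective_gog C GG)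
    (v : base GG) (hv : vtx v)
    (P : topGroupType) (hP : is_Pi1_at C v P)
    (Q : topGroupType) (nu : tot GG -> Q) (hQ : is_Pi1 C nu) :
  topgroup_isomorphic P Q.
Proof.
have [D [Ph [iota [f [p [cpl hf hp limP]]]]]] := hP.
have [pQ [U [j [nu' [uU zj specQ]]]]] := hQ.
apply: (correspondence_isomorphic (C := C)
  (R := fun H phi psi => corresponds iota p nu j nu' phi psi)).
- apply: (limit_determined (fd_directed D) _ _ _ limP _ hp).
  + by move=> i; exact: (completion_compact hC (cpl i)).
  + by move=> i; exact: (completion_zero_dimensional (cpl i)).
  + by move=> i; exact: (completion_determined hC (cpl i)).
  + by move=> i k /hf [[]].
- exact: proC_determined.
- by move=> H phi CH lphi; exact: (corresponds_ex_Q hC hv cpl hf).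
- by move=> H psi CH lpsi; exact: (corresponds_ex_P hC cpl hp limP zj specQ CH lpsi).
- move=> H phi psi psi' CH _ l l'.
  exact: (corresponds_unique_Q hC hv cpl hf limP uU zj specQ).
- move=> H psi phi phi' _ _ _ _.
  exact: (corresponds_unique_P hC hv cpl hf limP).
- by move=> H K phi psi k CH CK hk; exact: corresponds_natural.
Qed.
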